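(* Let $a_1,\ldots,a_n\in C^\infty(\mathbb{T}^n)$ be real-valued and let $X_j=\partial_{t_j}+a_j(t)\partial_x$, $j\in\{1,\ldots,n\}$, be the associated real vector fields on $\mathbb{T}^{n+1}=\mathbb{T}^n_t\times\mathbb{T}_x$. Let $u\in\mathcal{D}'(\mathbb{T}^{n+1})$. Suppose that $X_ju\in C^\infty(\mathbb{T}^{n+1})$ for every $j\in\{1,\ldots,n\}$ and that there exists $s=(s_1,\ldots,s_n)\in\mathbb{T}^n$ such that for every $k\in\mathbb{Z}_+$ there is $C_k>0$ with $$|\hat u(s,\xi)|\le C_k(1+|\xi|)^{-k},\quad\forall\,\xi\in\mathbb{Z}.$$ Then $u\in C^\infty(\mathbb{T}^{n+1})$.
   Context: $\mathbb{T}=\mathbb{R}/2\pi\mathbb{Z}$, $\mathbb{Z}_+=\{0,1,2,\ldots\}$; the $X_j$ are not assumed to commute. For $u\in\mathcal{D}'(\mathbb{T}^{n+1})$ and $\xi\in\mathbb{Z}$, $\hat u(\cdot,\xi)\in\mathcal{D}'(\mathbb{T}^n)$ denotes the partial Fourier coefficient of $u$ in the variable $x$, so that $u=\sum_{\xi\in\mathbb{Z}}\hat u(t,\xi)e^{ix\xi}$ (formally $\hat u(t,\xi)=\frac1{2\pi}\int_0^{2\pi}u(t,x)e^{-ix\xi}\,dx$). When $X_ju\in C^\infty(\mathbb{T}^{n+1})$ for all $j$, each $\hat u(\cdot,\xi)$ is a smooth function on $\mathbb{T}^n$ (by ellipticity in $t$), so the pointwise value $\hat u(s,\xi)$ makes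 sense. *)

(* Defs.v *)
From mathcomp Require Import all_boot all_order all_algebra.
From mathcomp Require Import complex.
From mathcomp Require Import all_classical all_reals all_analysis.

Set Implicit Arguments.
Unset Strict Implicit.
Unset Printing Implicit Defensive.

Import Order.TTheory GRing.Theory Num.Theory.
Import numFieldNormedType.Exports.

Local Open Scope classical_set_scope.
Local Open Scope ring_scope.
Local Open Scope complex_scope.

(* Functions on the torus T^N = (R / 2 pi Z)^N are represented by functions on
   R^N that are 2 pi-periodic in every coordinate; a point of T^N is represented
   by any of its lifts in R^N. *)
Section SmoothFunctions.
Context {R : realType} {N : nat}.

Definition partial (i : 'I_N) (f : 'rV[R]_N -> R) : 'rV[R]_N -> R :=
  fun x => 'D_(delta_mx 0 i) f x.

Definition partials (l : seq 'I_N) (f : 'rV[R]_N -> R) : 'rV[R]_N -> R :=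
  foldr partial f l.

Definition smooth (f : 'rV[R]_N -> R) : Prop :=
  forall l : seq 'I_N,
    continuous (partials l f) /\
    (forall i x, derivable (partials l f) x (delta_mx 0 i)).

Definition torus_periodic (T : zmodType) (f : 'rV[R]_N -> T) : Prop :=
  forall i : 'I_N, periodic f ((2 * pi) *: delta_mx 0 i).

Definition smooth_torus_real (f : 'rV[R]_N -> R) : Prop :=
  smooth f /\ torus_periodic f.

Definition re (f : 'rV[R]_N -> R[i]) : 'rV[R]_N -> R := fun x => complex.Re (f x).
Definition im (f : 'rV[R]_N -> R[i]) : 'rV[R]_N -> R := fun x => complex.Im (f x).

Definition smooth_torus (f : 'rV[R]_N -> R[i]) : Prop :=
  [/\ smooth (re f), smooth (im f) & torus_periodic f].

Definition cpartial (i : 'I_N) (f : 'rV[R]_N -> R[i]) : 'rV[R]_N -> R[i] :=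
  fun x => partial i (re f) x +i* partial i (im f) x.

Definition cpartials (l : seq 'I_N) (f : 'rV[R]_N -> R[i]) :
    'rV[R]_N -> R[i] :=
  foldr cpartial f l.

End SmoothFunctions.

(* Iterated integral over [0, 2 pi]^N; it is only applied to continuous
   functions, for which it is the (unnormalized) Lebesgue integral over T^N. *)
Fixpoint torus_int {R : realType} (N : nat) : ('rV[R]_N -> R) -> R :=
  match N return ('rV[R]_N -> R) -> R with
  | 0 => fun f => f 0
  | N'.+1 => fun f =>
      \int[lebesgue_measure]_(x in `[0, 2 * pi]%classic)
        torus_int (fun y : 'rV[R]_N' => f (row_mx (x%:M : 'rV[R]_1) y))
  end.

Definition torus_cint {R : realType} (N : nat) (f : 'rV[R]_N -> R[i]) : R[i] :=
  torus_int (re f) +i* torus_int (im f).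

Section Distributions.
Context {R : realType} {N : nat}.

(* Only the values of such a functional on smooth_torus functions are
   meaningful. *)
Definition functional : Type := ('rV[R]_N -> R[i]) -> R[i].

(* Elements of D'(T^N).  The last conjunct is continuity for the topology of
   C^oo(T^N) defined by the seminorms
     p_m(phi) = max_(size l <= m) sup_x `|cpartials l phi x| :
   it says `|u phi| <= C * M whenever p_m(phi) <= M. *)
Definition is_distribution (u : functional) : Prop :=
  (forall (c : R[i]) (phi psi : 'rV[R]_N -> R[i]),
      smooth_torus phi -> smooth_torus psi ->
      u (fun x => c * phi x + psi x) = c * u phi + u psi) /\
  (exists (C : R) (m : nat), forall (phi : 'rV[R]_N -> R[i]) (M : R),
      smooth_torus phi ->
      (forall l : seq 'I_N, (size l <= m)%N ->
         forall x, `|cpartials l phi x| <= M%:C) ->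
      `|u phi| <= (C * M)%:C).

Definition dist_add (u v : functional) : functional :=
  fun phi => u phi + v phi.

Definition dist_mul (a : 'rV[R]_N -> R) (u : functional) : functional :=
  fun phi => u (fun x => (a x)%:C * phi x).

Definition dist_partial (i : 'I_N) (u : functional) : functional :=
  fun phi => - u (cpartial i phi).

Definition represents (f : 'rV[R]_N -> R[i]) (u : functional) : Prop :=
  forall phi, smooth_torus phi -> u phi = torus_cint (fun x => f x * phi x).

Definition dist_smooth (u : functional) : Prop :=
  exists2 f, smooth_torus f & represents f u.

(* The value at s of the smooth function representing u (unique if it exists);
   0 if u is not smooth. *)
Definition value_at (u : functional) (s : 'rV[R]_N) : R[i] :=
  xget 0 [set z | exists f, [/\ smooth_torus f, represents f u & z = f s]].

End Distributions.
Arguments functional : clear implicits.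

Section PartialFourier.
Context {R : realType} {n : nat}.

(* Points of T^(n + 1) = T^n_t * T_x are written row_mx t x. *)
Definition tvar (z : 'rV[R]_(n + 1)) : 'rV[R]_n := lsubmx z.
Definition xvar (z : 'rV[R]_(n + 1)) : R := rsubmx z 0 0.

Definition vector_field (a : 'I_n -> 'rV[R]_n -> R) (j : 'I_n)
    (u : functional R (n + 1)) : functional R (n + 1) :=
  dist_add (dist_partial (lshift 1 j) u)
           (dist_mul (fun z => a j (tvar z)) (dist_partial (rshift n ord0) u)).

Definition expi (theta : R) : R[i] := cos theta +i* sin theta.

(* <hat u(., xi), psi> = 1/(2 pi) <u, psi(t) e^(- i x xi)> *)
Definition partial_fourier (u : functional R (n + 1)) (xi : int) :
    functional R n :=
  fun psi => ((2 * pi)^-1)%:C *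
    u (fun z => psi (tvar z) * expi (- (xvar z * xi%:~R))).

End PartialFourier.

(* Main.v *)
(** A distribution on a torus is smooth as soon as its Fourier coefficients decrease
    rapidly.  Put [U k xi] for the value of [u] on [exp (i (k . t + xi x))].  Testing
    [X_j u = f_j] against this character expresses [i k_j U k xi] as [- i xi] times the
    convolution of [U . xi] with the Fourier coefficients of [a_j], up to a Fourier
    coefficient of [f_j].  Convolution with rapidly decreasing coefficients preserves
    polynomial growth and decay in [k], so this identity gains one power of [1 + |k|],
    and can be iterated.
    For fixed [xi] the iteration starts from the finite order of [u] and shows that
    [g = \hat u (., xi)] is smooth.  Then [\partial_j g + i xi a_j g] is bounded by any
    power of [(1 + |xi|)^-1], and since [i xi a_j] is purely imaginary, [|g|] can
    be propagated along the coordinate directions from [s] to the whole torus without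
    exponential loss in [xi].  Hence [U k xi] decreases rapidly in [xi], uniformly in [k],
    and iterating the identity once more gives rapid decrease in [(k, xi)]. *)

Require Import Defs.
From mathcomp Require Import all_boot all_order all_algebra.
From mathcomp Require Import complex.
From mathcomp Require Import all_classical all_reals all_analysis.
From mathcomp Require Import ring lra.

Set Implicit Arguments.
Unset Strict Implicit.
Unset Printing Implicit Defensive.

Import Order.TTheory GRing.Theory Num.Theory.
Import numFieldNormedType.Exports.
Import Normc.

Local Open Scope classical_set_scope.
Local Open Scope ring_scope.
Local Open Scope complex_scope.

(** * Complex numbers and integrals in one variable *)

(** The difficulty is uniformity in [xi]. One gain of a power of [1 + |k|] costs a factor
    [1 + B |xi|], with [B] independent of [xi]. At fixed [xi] this is harmless, but starting from
    the finite order of [u] the resulting bounds grow with [xi], faster at each gain, so this first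
    run yields only the smoothness of [g]. In the second run every power of [k] is paid for with one
    power of [xi], so decay of all orders in [xi], uniform in [k], must already be available: this
    is what propagation supplies. Its constant depends on [n] alone. It joins [s] to any point by
    segments parallel to the axes and uses on each of them only the equation of that direction, so
    no relation between the fields is involved. The one nontrivial fact about Fourier series is that
    a continuous periodic function with zero coefficients vanishes. It is proved with powers of a
    trigonometric polynomial that exceeds 1 only near a given point. Inversion, and the expansion of
    a distribution over characters, then follow by comparing absolutely convergent sums, all
    dominated by the single weight [wt]. *)

Section ComplexNumbers.
Context {R : realType}.
Implicit Types (z w : R[i]) (t : R).

Lemma norm_normc z : `|z| = (normc z)%:C.
Proof. by []. Qed.

Lemma le_normc_lec z t : (`|z| <= t%:C) = (normc z <= t).
Proof. by rewrite norm_normc lecR. Qed.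

Lemma normc_ge0 z : 0 <= normc z.
Proof. by case: z => a b; rewrite /= sqrtr_ge0. Qed.

Lemma normcD z w : normc (z + w) <= normc z + normc w.
Proof. by rewrite -lecR rmorphD/=; exact: (@ler_normD _ R[i]). Qed.

Lemma normc_opp z : normc (- z) = normc z.
Proof. by case: z => a b /=; rewrite !sqrrN. Qed.

Lemma normc_real t : normc t%:C = `|t|.
Proof. by rewrite /= expr0n addr0 sqrtr_sqr. Qed.

Lemma normc_i t : normc (0 +i* t) = `|t|.
Proof. by rewrite /= expr0n add0r sqrtr_sqr. Qed.

Lemma Re_le_normc z : `|complex.Re z| <= normc z.
Proof. by case: z => a b /=; rewrite -sqrtr_sqr ler_sqrt ?addr_ge0 ?sqr_ge0// lerDl sqr_ge0. Qed.

Lemma Im_le_normc z : `|complex.Im z| <= normc z.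
Proof. by case: z => a b /=; rewrite -sqrtr_sqr ler_sqrt ?addr_ge0 ?sqr_ge0// lerDr sqr_ge0. Qed.

Lemma normc_le_ReIm z : normc z <= `|complex.Re z| + `|complex.Im z|.
Proof.
case: z => a b /=.
rewrite -[leRHS]ger0_norm ?addr_ge0// -sqrtr_sqr ler_sqrt ?sqr_ge0//.
by rewrite sqrrD !real_normK ?num_real// lerD2r lerDl mulrn_wge0// mulr_ge0.
Qed.

Lemma normc_sqr z : normc z ^+ 2 = complex.Re z ^+ 2 + complex.Im z ^+ 2.
Proof. by case: z => a b /=; rewrite sqr_sqrtr// addr_ge0 ?sqr_ge0. Qed.

Lemma normc_eq0P z : normc z <= 0 -> z = 0.
Proof. by move=> z0; apply: eq0_normc; apply/eqP; rewrite eq_le z0 normc_ge0. Qed.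

Lemma normc_expi t : normc (expi t) = 1.
Proof. by rewrite /= cos2Dsin2 sqrtr1. Qed.

Lemma expiD (s t : R) : expi (s + t) = expi s * expi t.
Proof.
by rewrite /expi cosD sinD; congr (_ +i* _);
  rewrite addrC [_ * cos t]mulrC [cos _ * sin t]mulrC mulrC addrC.
Qed.

Lemma expi0 : expi 0 = 1 :> R[i].
Proof. by rewrite /expi cos0 sin0. Qed.

Lemma cReM z w :
  complex.Re (z * w) = complex.Re z * complex.Re w - complex.Im z * complex.Im w.
Proof. by case: z; case: w. Qed.

Lemma cImM z w :
  complex.Im (z * w) = complex.Re z * complex.Im w + complex.Im z * complex.Re w.
Proof. by case: z; case: w. Qed.

Lemma cReD z w : complex.Re (z + w) = complex.Re z + complex.Re w.
Proof. by case: z; case: w. Qed.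

Lemma cImD z w : complex.Im (z + w) = complex.Im z + complex.Im w.
Proof. by case: z; case: w. Qed.

Lemma cReN z : complex.Re (- z) = - complex.Re z. Proof. by case: z. Qed.
Lemma cImN z : complex.Im (- z) = - complex.Im z. Proof. by case: z. Qed.

Lemma cRe_sum (I : Type) (s : seq I) (P : pred I) (F : I -> R[i]) :
  complex.Re (\sum_(i <- s | P i) F i) = \sum_(i <- s | P i) complex.Re (F i).
Proof. by apply: (big_morph _ cReD). Qed.

Lemma cIm_sum (I : Type) (s : seq I) (P : pred I) (F : I -> R[i]) :
  complex.Im (\sum_(i <- s | P i) F i) = \sum_(i <- s | P i) complex.Im (F i).
Proof. by apply: (big_morph _ cImD). Qed.

Lemma complexP z w : complex.Re z = complex.Re w -> complex.Im z = complex.Im w -> z = w.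
Proof. by case: z; case: w => a b c d /= -> ->. Qed.

End ComplexNumbers.

Lemma continuous_pair_cst (T U : topologicalType) (q : T) :
  continuous (fun x : U => (q, x)).
Proof. by move=> x; apply: cvg_pair; [exact: cvg_cst|exact: cvg_id]. Qed.

(** Compactness makes the continuity in [q] at [p] uniform over [x] in [K]. Limits can then be taken
    under the integral by sup estimates, without a convergence theorem for measurable functions. *)
Lemma near_compact_continuous (R : realType) (T U : topologicalType)
    (H : T * U -> R) (K : set U) (p : T) (e : R) :
  continuous H -> compact K -> 0 < e ->
  \forall q \near p, forall x, K x -> `|H (p, x) - H (q, x)| <= e.
Proof.
move=> cH /compact_near_coveringP nc e0.
have : \forall q \near p, K `<=` (fun x => `|H (p, x) - H (q, x)| <= e).
  apply: nc => x _.
  have H1 : \forall z \near nbhs (p, x), `|H (p, x) - H z| <= e / 2.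
    by move/cvgrPdist_le: (cH (p, x)) => /(_ (e / 2)); apply; rewrite divr_gt0.
  have H2 : \forall x' \near nbhs x, `|H (p, x) - H (p, x')| <= e / 2.
    have cHp : continuous (fun x => H (p, x)).
      move=> x0; apply: continuous_comp; last exact: cH.
      exact: continuous_pair_cst.
    by move/cvgrPdist_le: (cHp x) => /(_ (e / 2)); apply; rewrite divr_gt0.
  case: H1 => -[U0 V] /= [pU xV] UV.
  exists ([set x' | V x' /\ `|H (p, x) - H (p, x')| <= e / 2], U0) => /=.
    by split => //; apply: filterI.
  move=> [x' q] /= [[Vx' hx'] Uq].
  have := UV (q, x') (conj Uq Vx') => /= hq.
  rewrite (_ : _ - _ = (H (p, x) - H (q, x')) - (H (p, x) - H (p, x'))); last by ring.
  by rewrite (le_trans (ler_normB _ _))// [leRHS]splitr lerD.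
exact.
Qed.

Section OneVariable.
Context {R : realType}.
Implicit Types (f g : R -> R).

Definition int1 f : R := \int[lebesgue_measure]_(x in `[0, 2 * pi]%classic) f x.

Lemma twopi_gt0 : 0 < 2 * pi :> R.
Proof. by rewrite mulr_gt0// pi_gt0. Qed.

Lemma int1_integrable f : continuous f ->
  lebesgue_measure.-integrable `[0, 2 * pi]%classic (EFin \o f).
Proof.
move=> cf; apply: continuous_compact_integrable; first exact: segment_compact.
exact: continuous_subspaceT.
Qed.

Lemma int1D f g : continuous f -> continuous g ->
  int1 (fun x => f x + g x) = int1 f + int1 g.
Proof. by move=> cf cg; rewrite /int1 RintegralD//; exact: int1_integrable. Qed.

Lemma int1Z c f : continuous f -> int1 (fun x => c * f x) = c * int1 f.
Proof. by move=> cf; rewrite /int1 RintegralZl//; exact: int1_integrable. Qed.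

Lemma int1_le f g : continuous f -> continuous g ->
  (forall x, 0 <= x <= 2 * pi -> f x <= g x) -> int1 f <= int1 g.
Proof.
move=> cf cg fg; apply: le_Rintegral => //.
  exact: int1_integrable.
exact: int1_integrable.
Qed.

Lemma int1_cst c : int1 (fun=> c) = c * (2 * pi).
Proof.
rewrite /int1 Rintegral_cst//= lebesgue_measure_itv/= lte_fin twopi_gt0/=.
by rewrite subr0.
Qed.

Lemma eq_int1 f g : f =1 g -> int1 f = int1 g.
Proof. by move=> /funext ->. Qed.

Lemma int1_param (T : topologicalType) (H : T * R -> R) :
  continuous H -> continuous (fun p => int1 (fun x => H (p, x))).
Proof.
move=> cH p; apply/cvgrPdist_le => e e0 /=.
have cHp q : continuous (fun x => H (q, x)).
  move=> x; apply: continuous_comp; last exact: cH.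
  exact: continuous_pair_cst.
pose e' := e / (2 * pi).
have e'0 : 0 < e' by rewrite divr_gt0// twopi_gt0.
have := near_compact_continuous p cH (@segment_compact R 0 (2 * pi)) e'0.
apply: filterS => q Uq.
rewrite -[_ - _]/(int1 _ - int1 _).
have -> : int1 (fun x => H (p, x)) - int1 (fun x => H (q, x)) =
  int1 (fun x => H (p, x) + -1 * H (q, x)).
  rewrite int1D ?int1Z ?mulN1r//; move=> x; apply: cvgM; [exact: cvg_cst|exact: cHp].
have cHH : continuous (fun x => H (p, x) + -1 * H (q, x)).
  move=> x; apply: cvgD; first exact: cHp.
  by apply: cvgM; [exact: cvg_cst|exact: cHp].
have ee : e = e' * (2 * pi) by rewrite divfK// gt_eqF// twopi_gt0.
rewrite ler_norml ee; apply/andP; split.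
  rewrite -mulNr -int1_cst; apply: int1_le => //; first by move=> ?; exact: cvg_cst.
  move=> x x2; have := Uq x; rewrite /= in_itv/= => /(_ x2).
  by rewrite ler_norml mulN1r => /andP[].
rewrite -int1_cst; apply: int1_le => //; first by move=> ?; exact: cvg_cst.
move=> x x2; have := Uq x; rewrite /= in_itv/= => /(_ x2).
by rewrite ler_norml mulN1r => /andP[].
Qed.

End OneVariable.

(** * Iterated integrals over the torus *)

Section TorusIntegral.
Context {R : realType}.

(** Spelled as in the body of [torus_int], so that [torus_intS] holds by conversion. *)
Definition cons_row N (x : R) (y : 'rV[R]_N) : 'rV[R]_N.+1 :=
  row_mx (x%:M : 'rV[R]_1) y.

Definition slice N (S : Type) (f : 'rV[R]_N.+1 -> S) (x : R) (y : 'rV[R]_N) : S :=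
  f (cons_row x y).

Lemma cons_row0 N x (y : 'rV[R]_N) : cons_row x y 0 ord0 = x.
Proof.
have -> : ord0 = lshift N (0 : 'I_1) by apply: val_inj.
by rewrite /cons_row; rewrite (@row_mxEl _ 1 1 N) mxE eqxx.
Qed.

Lemma cons_rowS N x (y : 'rV[R]_N) i : cons_row x y 0 (lift ord0 i) = y 0 i.
Proof.
have -> : lift ord0 i = rshift 1 i by apply: val_inj.
by rewrite /cons_row; rewrite (@row_mxEr _ 1 1 N).
Qed.

Lemma cons_row_continuous N :
  continuous (fun p : R * 'rV[R]_N => cons_row p.1 p.2).
Proof.
move=> p; apply/cvg_ballP => e e0.
have [U V] : (\forall x \near p.1, ball p.1 e x) /\ (\forall y \near p.2, ball p.2 e y).
  by split; exact: nbhsx_ballx.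
exists ([set x | ball p.1 e x], [set y | ball p.2 e y]) => //= -[x y] [/= px [_ py]].
split=> // i j; rewrite !ord1.
case: (unliftP ord0 j) => [k|] ->.
  by rewrite !cons_rowS.
by rewrite !cons_row0.
Qed.

Lemma continuous_compose (T U V : topologicalType) (f : T -> U) (g : U -> V) :
  continuous f -> continuous g -> continuous (fun x => g (f x)).
Proof. by move=> cf cg x; apply: continuous_comp; [exact: cf|exact: cg]. Qed.

Lemma continuous_pair (T U V : topologicalType) (f : T -> U) (g : T -> V) :
  continuous f -> continuous g -> continuous (fun x => (f x, g x)).
Proof. by move=> cf cg x; apply: cvg_pair; [exact: cf|exact: cg]. Qed.

Lemma continuous_cst (T U : topologicalType) (c : U) : continuous (fun _ : T => c).
Proof. by move=> x; exact: cvg_cst. Qed.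

Lemma continuous_fst (T U : topologicalType) : continuous (fun p : T * U => p.1).
Proof. by move=> x; exact: cvg_fst. Qed.

Lemma continuous_snd (T U : topologicalType) : continuous (fun p : T * U => p.2).
Proof. by move=> x; exact: cvg_snd. Qed.

Lemma continuous_add (T : topologicalType) (f g : T -> R) :
  continuous f -> continuous g -> continuous (fun x => f x + g x).
Proof. by move=> cf cg x; exact: cvgD (cf x) (cg x). Qed.

Lemma continuous_mul (T : topologicalType) (f g : T -> R) :
  continuous f -> continuous g -> continuous (fun x => f x * g x).
Proof. by move=> cf cg x; exact: cvgM (cf x) (cg x). Qed.

Lemma continuous_scale (T : topologicalType) (c : R) (f : T -> R) :
  continuous f -> continuous (fun x => c * f x).
Proof. by move=> cf; apply: continuous_mul cf; exact: continuous_cst. Qed.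

(** The induction enlarges the parameter space: the outer integration variable joins the parameter,
    so [T] becomes [T * R]. This is why [T] is an arbitrary topological space. *)
Lemma torus_int_param N (T : topologicalType) (G : T * 'rV[R]_N -> R) :
  continuous G -> continuous (fun p => torus_int (fun y => G (p, y))).
Proof.
elim: N T G => [|N IH] T G cG /=.
  apply: continuous_compose cG; apply: continuous_pair; last exact: continuous_cst.
  by move=> ?; exact: cvg_id.
apply: (@int1_param _ _ (fun q => torus_int (fun y => G (q.1, cons_row q.2 y)))).
apply: (IH _ (fun q => G (q.1.1, cons_row q.1.2 q.2))).
have c1 : continuous (fun q : T * R * 'rV[R]_N => q.1.1).
  exact: continuous_compose (@continuous_fst _ _) (@continuous_fst _ _).
have c2 : continuous (fun q : T * R * 'rV[R]_N => q.1.2).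
  exact: continuous_compose (@continuous_fst _ _) (@continuous_snd _ _).
apply: continuous_compose cG; apply: (continuous_pair c1).
have c3 := continuous_pair c2 (@continuous_snd _ _).
exact: continuous_compose c3 (@cons_row_continuous N).
Qed.

Lemma slice_continuous N (f : 'rV[R]_N.+1 -> R) x :
  continuous f -> continuous (slice f x).
Proof.
move=> cf; apply: continuous_compose cf.
exact: continuous_compose (@continuous_pair_cst _ _ x) (@cons_row_continuous N).
Qed.

Lemma slice_int_continuous N (f : 'rV[R]_N.+1 -> R) :
  continuous f -> continuous (fun x => torus_int (slice f x)).
Proof.
move=> cf; apply: (@torus_int_param _ _ (fun p => f (cons_row p.1 p.2))).
exact: continuous_compose (@cons_row_continuous N) cf.
Qed.

Lemma torus_intS N (f : 'rV[R]_N.+1 -> R) :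
  torus_int f = int1 (fun x => torus_int (slice f x)).
Proof. by []. Qed.

Lemma torus_intD N (f g : 'rV[R]_N -> R) : continuous f -> continuous g ->
  torus_int (fun x => f x + g x) = torus_int f + torus_int g.
Proof.
elim: N f g => [//|N IH] f g cf cg; rewrite !torus_intS.
rewrite -int1D; [|exact: slice_int_continuous..].
by apply: eq_int1 => x; rewrite -IH//; exact: slice_continuous.
Qed.

Lemma torus_intZ N c (f : 'rV[R]_N -> R) : continuous f ->
  torus_int (fun x => c * f x) = c * torus_int f.
Proof.
elim: N f => [//|N IH] f cf; rewrite !torus_intS.
rewrite -int1Z; last exact: slice_int_continuous.
by apply: eq_int1 => x; rewrite -IH//; exact: slice_continuous.
Qed.

Definition box N : set 'rV[R]_N := [set y | forall i, `[0, 2 * pi]%classic (y 0 i)].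

Lemma box_compact N : compact (@box N).
Proof. exact: (@rV_compact R N (fun=> `[0, 2 * pi]%classic) (fun=> @segment_compact R _ _)). Qed.

Lemma box_cons_row N (x : R) (y : 'rV[R]_N) : 0 <= x <= 2 * pi ->
  box y -> box (cons_row x y).
Proof.
move=> hx hy j; case: (unliftP ord0 j) => [k|] ->; last by rewrite cons_row0 /= in_itv.
by rewrite cons_rowS; exact: hy.
Qed.

Lemma torus_int_le N (f g : 'rV[R]_N -> R) : continuous f -> continuous g ->
  (forall x, box x -> f x <= g x) -> torus_int f <= torus_int g.
Proof.
elim: N f g => [|N IH] f g cf cg fg.
  by apply: fg => -[].
rewrite !torus_intS; apply: int1_le; [exact: slice_int_continuous..|].
move=> x hx; apply: IH; [exact: slice_continuous..|].
by move=> y hy; apply: fg; exact: box_cons_row.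
Qed.

Lemma torus_int_cst N c : torus_int (fun _ : 'rV[R]_N => c) = c * (2 * pi) ^+ N.
Proof.
elim: N => [|N IH]; first by rewrite expr0 mulr1.
by rewrite torus_intS /slice IH int1_cst -mulrA -exprSr.
Qed.

Lemma torus_int_abs N (f : 'rV[R]_N -> R) M : continuous f ->
  (forall x, box x -> `|f x| <= M) -> `|torus_int f| <= M * (2 * pi) ^+ N.
Proof.
move=> cf fM; rewrite ler_norml -mulNr -!torus_int_cst.
apply/andP; split; apply: torus_int_le => //; try exact: continuous_cst.
  by move=> x /fM; rewrite ler_norml => /andP[].
by move=> x /fM; rewrite ler_norml => /andP[].
Qed.

End TorusIntegral.

(** * Differentiation under the integral sign, and periodicity in place of boundary terms *)

Section TorusIntegralPartial.
Context {R : realType}.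

Lemma line_derive N (f : 'rV[R]_N -> R) (v y : 'rV[R]_N) (t : R) :
  derivable f (t *: v + y) v ->
  is_derive t 1 (fun s : R => f (s *: v + y)) ('D_v f (t *: v + y)).
Proof.
have E : (fun h : R => h^-1 *: (f (h *: v + (t *: v + y)) - f (t *: v + y))) =
  (fun h : R => h^-1 *: (f ((h *: (1 : R) + t) *: v + y) - f (t *: v + y))).
  by apply/funext => h; rewrite [h *: (1 : R)]mulr1 scalerDl addrA.
rewrite /derivable E => d; apply: DeriveDef => //.
by rewrite /derive E.
Qed.

Lemma MVT_between (g dg : R -> R) (h : R) :
  (forall t : R, is_derive t 1 g (dg t)) ->
  exists2 c, `|c| <= `|h| & g h - g 0 = dg c * h.
Proof.
move=> gd.
have cg : continuous g.
  by move=> x; apply: differentiable_continuous; apply/derivable1_diffP; case: (gd x).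
have [h0|h0] := leP 0 h.
  have [c] := @MVT_segment _ g dg 0 h h0 (fun x _ => gd x) (continuous_subspaceT cg).
  rewrite in_itv/= subr0 => /andP[c0 ch] ->; exists c => //.
  by rewrite !ger0_norm.
have [c] := @MVT_segment _ g dg h 0 (ltW h0) (fun x _ => gd x) (continuous_subspaceT cg).
rewrite in_itv/= sub0r => /andP[ch c0] E; exists c.
  by rewrite !ler0_norm ?lerN2// ltW.
by rewrite -opprB E mulrN opprK.
Qed.

Lemma cons_rowDS N x (y : 'rV[R]_N) (h : R) k :
  h *: delta_mx 0 (lift ord0 k) + cons_row x y = cons_row x (h *: delta_mx 0 k + y).
Proof.
apply/rowP => j; rewrite mxE [X in X + _]mxE [X in _ * X]mxE.
case: (unliftP ord0 j) => [m|] ->.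
  by rewrite !cons_rowS !mxE/= (inj_eq (@lift_inj _ _)).
by rewrite !cons_row0 /= mulr0 add0r.
Qed.

Lemma cons_rowD0 N x (y : 'rV[R]_N) (h : R) :
  h *: delta_mx 0 ord0 + cons_row x y = cons_row (h + x) y.
Proof.
apply/rowP => j; rewrite mxE [X in X + _]mxE [X in _ * X]mxE.
case: (unliftP ord0 j) => [m|] ->.
  by rewrite !cons_rowS /= mulr0 add0r.
by rewrite !cons_row0 /= mulr1.
Qed.

Lemma slice_line N (f : 'rV[R]_N.+1 -> R) k x y :
  (fun h : R => h^-1 *: (slice f x (h *: delta_mx 0 k + y) - slice f x y)) =
  (fun h : R => h^-1 *: (f (h *: delta_mx 0 (lift ord0 k) + cons_row x y) -
                         f (cons_row x y))).
Proof. by apply/funext => h; rewrite cons_rowDS. Qed.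

Lemma partial_slice N (f : 'rV[R]_N.+1 -> R) k x :
  slice (partial (lift ord0 k) f) x = partial k (slice f x).
Proof. by apply/funext => y; rewrite /partial /derive slice_line. Qed.

Lemma derivable_slice N (f : 'rV[R]_N.+1 -> R) k x y :
  derivable f (cons_row x y) (delta_mx 0 (lift ord0 k)) ->
  derivable (slice f x) y (delta_mx 0 k).
Proof. by rewrite /derivable slice_line. Qed.

(** The mean value theorem replaces the difference quotient by the partial derivative at a nearby
    point, and uniform continuity over the compact [box] makes the error small before
    integrating. *)
Lemma slice_int_derive N (f : 'rV[R]_N.+1 -> R) (x : R) :
  continuous f -> (forall z, derivable f z (delta_mx 0 ord0)) ->
  continuous (partial ord0 f) ->
  is_derive x 1 (fun s => torus_int (slice f s)) (torus_int (slice (partial ord0 f) x)).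
Proof.
move=> cf df cdf.
pose D (p : R * 'rV[R]_N) := partial ord0 f (cons_row (p.1 + x) p.2).
have cD : continuous D.
  apply: continuous_compose cdf.
  have c1 : continuous (fun p : R * 'rV[R]_N => p.1 + x).
    by move=> p; apply: cvgD; [exact: cvg_fst|exact: cvg_cst].
  exact: continuous_compose (continuous_pair c1 (@continuous_snd _ _)) (@cons_row_continuous _ N).
suff F : (fun h : R => h^-1 *: (torus_int (slice f (h *: (1 : R) + x)) - torus_int (slice f x)))
    @ 0^' --> torus_int (slice (partial ord0 f) x).
  by apply: DeriveDef; [apply/cvg_ex; eexists; exact: F|exact: cvg_lim F].
apply/cvgrPdist_le => e e0 /=.
pose e' := e / (2 * pi) ^+ N.
have p0 : 0 < (2 * pi : R) ^+ N by rewrite exprn_gt0// twopi_gt0.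
have e'0 : 0 < e' by rewrite divr_gt0.
have := near_compact_continuous 0 cD (@box_compact R N) e'0.
move=> /nbhs_ballP[d /= d0 dD].
apply/nbhs_ballP; exists d => //= h hd h0.
rewrite [h *: _]mulr1.
(* The derivative minus the difference quotient, with subtractions written as [-1 *] so that
   [torus_intD] and [torus_intZ] apply. *)
pose g (y : 'rV[R]_N) := slice (partial ord0 f) x y + - h^-1 * (slice f (h + x) y + -1 * slice f x y).
have cs t : continuous (slice f t) by exact: slice_continuous.
have cs1 t : continuous (fun y => -1 * slice f t y).
  exact: continuous_scale.
have cs2 : continuous (fun y => slice f (h + x) y + -1 * slice f x y).
  exact: continuous_add.
have cs3 : continuous (slice (partial ord0 f) x) by exact: slice_continuous.
have cs4 : continuous (fun y => - h^-1 * (slice f (h + x) y + -1 * slice f x y)).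
  exact: continuous_scale.
have -> : torus_int (slice (partial ord0 f) x) -
    h^-1 *: (torus_int (slice f (h + x)) - torus_int (slice f x)) = torus_int g.
  by rewrite torus_intD// torus_intZ// torus_intD// torus_intZ// mulN1r mulNr.
have -> : e = e' * (2 * pi) ^+ N by rewrite divfK// gt_eqF.
apply: torus_int_abs.
  exact: continuous_add.
move=> y By.
have gd (t : R) : is_derive t 1 (fun s : R => f (s *: delta_mx 0 ord0 + cons_row x y)) (D (t, y)).
  by rewrite /D /= -cons_rowD0; exact: line_derive.
(* The point [c] depends on [y], with no regularity; only [|c| <= |h|] is used, the continuity of
   [g] being known from its definition. *)
have [c ch] := MVT_between h gd.
rewrite scale0r add0r cons_rowD0 => E.
have -> : g y = D (0, y) - D (c, y).
  rewrite /g /D /= add0r; congr (_ + _).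
  by rewrite mulN1r /slice E/= /D mulNr mulrCA mulVf// mulr1.
apply: dD => //=.
by move: hd; rewrite /ball/= !sub0r !normrN; exact: le_lt_trans.
Qed.

(** If [i] is the outermost variable, the fundamental theorem of calculus leaves [F (2 * pi) - F 0],
    which is zero by periodicity; otherwise the induction hypothesis applies to every slice. Applied
    to products, this is integration by parts. *)
Lemma torus_int_partial N (i : 'I_N) (f : 'rV[R]_N -> R) :
  continuous f -> (forall x, derivable f x (delta_mx 0 i)) ->
  continuous (partial i f) -> periodic f ((2 * pi) *: delta_mx 0 i) ->
  torus_int (partial i f) = 0.
Proof.
elim: N i f => [[]//|N IH] i f cf df cdf pf.
rewrite torus_intS; case: (unliftP ord0 i) => [k|] iE; rewrite {}iE in df cdf pf *.
  rewrite (_ : (fun x => _) = fun=> 0); first by rewrite int1_cst mul0r.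
  apply/funext => x; rewrite partial_slice; apply: IH.
  - exact: slice_continuous.
  - by move=> y; apply: derivable_slice; exact: df.
  - by rewrite -partial_slice; exact: slice_continuous.
  - move=> y; rewrite /slice addrC -cons_rowDS addrC.
    exact: pf.
pose F x := torus_int (slice f x).
have dF (x : R) : is_derive x 1 F (torus_int (slice (partial ord0 f) x)).
  exact: slice_int_derive.
have cF : continuous F by exact: slice_int_continuous.
rewrite /int1 /Rintegral (@continuous_FTC2 _ _ F).
- have -> : F (2 * pi) = F 0.
    rewrite /F; congr torus_int; apply/funext => y; rewrite /slice.
    by rewrite -[X in cons_row X]addr0 -cons_rowD0 addrC; exact: pf.
  by rewrite /= subrr.
- exact: twopi_gt0.
- by apply: continuous_subspaceT; exact: slice_int_continuous.
- split.
  + by move=> x _; case: (dF x).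
  + by apply: cvg_at_right_filter; exact: cF.
  + by apply: cvg_at_left_filter; exact: cF.
- by move=> x _; rewrite derive1E; case: (dF x).
Qed.

End TorusIntegralPartial.

(** * Uniqueness of Fourier coefficients *)

Section Positivity.
Context {R : realType}.

Lemma compact_bound (T : topologicalType) (K : set T) (f : T -> R) :
  continuous f -> compact K -> exists M, forall x, K x -> `|f x| <= M.
Proof.
move=> cf cK.
have /compact_bounded[M [_ MA]] : compact (f @` K).
  by apply: continuous_compact => //; exact: continuous_subspaceT.
by exists (M + 1) => x Kx; apply: (MA (M + 1)); rewrite ?ltrDl//; exists x.
Qed.

(** By continuity [f] stays above [f x0 / 2] on an interval of radius [r] around [x0]; as [x0] is
    interior, that interval can be kept inside [[0, 2 pi]], and the integral is at least
    [c * (r + r)]. *)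
Lemma int1_gt0 (f : R -> R) (x0 : R) : continuous f -> (forall x, 0 <= f x) ->
  0 < x0 < 2 * pi -> 0 < f x0 -> 0 < int1 f.
Proof.
move=> cf f0 /andP[x0_gt0 x0_lt] fx0.
pose c := f x0 / 2.
have c0 : 0 < c by rewrite divr_gt0.
have /cvgrPdist_le /(_ c c0) /nbhs_ballP[d /= d0 dD] := cf x0.
pose r := Num.min (d / 2) (Num.min x0 (2 * pi - x0)).
have r0 : 0 < r by rewrite !lt_min x0_gt0 subr_gt0 x0_lt divr_gt0.
have rd : r <= d / 2 by rewrite ge_min lexx.
have rx : r <= x0 by rewrite !ge_min lexx orbT.
have rp : r <= 2 * pi - x0 by rewrite !ge_min lexx !orbT.
have AB : `[x0 - r, x0 + r]%classic `<=` `[0, 2 * pi]%classic.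
  by move=> x /=; rewrite !in_itv/= => /andP[? ?]; lra.
have /integrableP[mf _] := int1_integrable cf.
have cr0 : 0 < c * (r + r) by rewrite mulr_gt0// addr_gt0.
apply: lt_le_trans cr0 _.
have If : (\int[lebesgue_measure]_(x in `[0%R, (2 * pi)%R]%classic) (f x)%:E)%E \is a fin_num.
  by apply: integrable_fin_num => //; exact: int1_integrable.
rewrite -lee_fin /int1 /Rintegral fineK//.
have -> : ((c * (r + r))%:E =
    \int[lebesgue_measure]_(x in `[(x0 - r)%R, (x0 + r)%R]%classic) (cst c%:E x))%E.
  rewrite integral_cst//= lebesgue_measure_itv/= lte_fin ltrD2l gtrN//=.
  by rewrite -EFinD EFinM opprD opprK addrACA subrr add0r.
apply: (@le_trans _ _ (\int[lebesgue_measure]_(x in `[(x0 - r)%R, (x0 + r)%R]%classic) (f x)%:E)%E).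
  apply: ge0_le_integral => //=.
  - by move=> x _; rewrite lee_fin ltW.
  - by apply: measurable_funS mf.
  - move=> x; rewrite in_itv/= => /andP[x1 x2]; rewrite lee_fin.
    have /dD : ball x0 d x by rewrite /ball/= ltr_norml; apply/andP; split; lra.
    by rewrite /= ler_norml /c => /andP[? ?]; lra.
apply: ge0_subset_integral => //=.
by move=> x _; rewrite lee_fin.
Qed.

Lemma bernoulli_ineq (x : R) n : 0 <= x -> 1 + x *+ n <= (1 + x) ^+ n.
Proof.
move=> x0; elim: n => [|n IH]; first by rewrite mulr0n addr0 expr0.
rewrite exprS; apply: (@le_trans _ _ ((1 + x) * (1 + x *+ n))).
  by rewrite mulrSr mulrDl mul1r mulrDr mulr1; have := mulr_ge0 x0 (mulrn_wge0 n x0); lra.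
by rewrite ler_wpM2l// addr_ge0.
Qed.

(** Cosine decreases on [[0, pi]]; beyond [pi], [|t|] is reflected to [2 pi - |t|]. *)
Lemma cos_le_far (d t : R) : 0 < d <= 1 -> d <= `|t| <= 2 * pi - d -> cos t <= cos d.
Proof.
move=> /andP[d0 d1] /andP[t1 t2]; rewrite -(cos_norm t).
have p2 := @pi_ge2 R.
have dI : d \in `[0, pi] by rewrite in_itv/=; lra.
have [tp|tp] := leP `|t| pi.
  rewrite leNgt; apply/negP; rewrite ltr_cos//; last by rewrite in_itv/= normr_ge0.
  by rewrite ltNge t1.
have -> : cos `|t| = cos (2 * pi - `|t|).
  by rewrite -[RHS]cosN opprB -[RHS]cosD2pi mulr_natl subrK.
rewrite leNgt; apply/negP; rewrite ltr_cos//; last by rewrite in_itv/=; lra.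
apply/negP; rewrite -leNgt; lra.
Qed.

(* Were [G x0] positive, the powers of the kernel, which stays below 1 away from
   [x0] and exceeds 1 near it, would make the integral blow up. *)
Lemma peak_kernel_le0 (G : R -> R) (x0 : R) : continuous G -> 0 < x0 < 2 * pi ->
  (forall d n, int1 (fun x => G x * (1 + (cos (x - x0) - cos d)) ^+ n) = 0) ->
  G x0 <= 0.
Proof.
move=> cG /andP[x0_gt0 x0_lt] HG; rewrite leNgt; apply/negP => Gx0.
pose c := G x0 / 2.
have c0 : 0 < c by rewrite divr_gt0.
have /cvgrPdist_le /(_ c c0) /nbhs_ballP[r /= r0 rD] := cG x0.
(* [d <= r / 2] keeps [G] above [c] within distance [d] of [x0]; [d <= 1] keeps [d] where cosine
   decreases; the last two bounds give [|x - x0| <= 2 pi - d] for all [x] in [[0, 2 pi]], so the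
   kernel has no second peak there. *)
pose d := Num.min (Num.min (r / 2) 1) (Num.min x0 (2 * pi - x0)).
have d0 : 0 < d by rewrite !lt_min x0_gt0 subr_gt0 x0_lt ltr01 divr_gt0.
have dr : d <= r / 2 by rewrite !ge_min lexx.
have d1 : d <= 1 by rewrite !ge_min lexx !orbT.
have dx : d <= x0 by rewrite !ge_min lexx !orbT.
have dp : d <= 2 * pi - x0 by rewrite !ge_min lexx !orbT.
have [M MG] := compact_bound cG (@segment_compact R 0 (2 * pi)).
pose y x := cos (x - x0) - cos d.
pose b x := 2^-1 * (y x + `|y x|).
have cy : continuous y.
  move=> x; apply: cvgB; last exact: cvg_cst.
  apply: continuous_comp; last exact: continuous_cos.
  by apply: cvgB; [exact: cvg_id|exact: cvg_cst].
have cb : continuous b.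
  apply: continuous_scale; apply: continuous_add => // x.
  by apply: cvg_norm; exact: cy.
have b0 x : 0 <= b x.
  by rewrite /b mulr_ge0// -lerBlDl sub0r; have := ler_norm (- y x); rewrite normrN.
have p2 := @pi_ge2 R.
have bx0 : 0 < b x0.
  rewrite /b /y subrr cos0 mulr_gt0// ltr_wpDr// subr_gt0 -cos0 ltr_cos// in_itv/=; lra.
have Ib : 0 < int1 b by apply: (int1_gt0 cb b0 _ bx0); rewrite x0_gt0.
(* [b] is the positive part of [y]. Where [y <= 0], [|1 + y| <= 1] bounds the product below by
   [- M]; near [x0], Bernoulli gives growth linear in [n]. Integrating contradicts the vanishing
   integrals for large [n]. *)
have lower n x : 0 <= x <= 2 * pi -> - M + c * n%:R * b x <= G x * (1 + y x) ^+ n.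
  move=> /andP[x1 x2].
  have GM : `|G x| <= M by apply: MG; rewrite /= in_itv/= x1.
  have M0 : 0 <= M by exact: le_trans GM.
  have [xd|xd] := leP d `|x - x0|.
    have yx : y x <= 0.
      rewrite subr_le0; apply: cos_le_far; first by rewrite d0.
      by rewrite xd/= ler_norml; apply/andP; split; lra.
    have -> : b x = 0 by rewrite /b ler0_norm// subrr mulr0.
    rewrite mulr0 addr0.
    have : `|G x * (1 + y x) ^+ n| <= M.
      rewrite normrM normrX -[leRHS]mulr1 ler_pM//.
      rewrite exprn_ile1// ler_norml.
      have := cos_geN1 (x - x0); have := cos_le1 d.
      by move: yx; rewrite /y; lra.
    by rewrite ler_norml => /andP[].
  have yx : 0 <= y x.
    rewrite subr_ge0 -(cos_norm (x - x0)) leNgt.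
    have n0 := normr_ge0 (x - x0).
    rewrite ltr_cos ?in_itv/=; first by rewrite -leNgt ltW.
      by apply/andP; split; lra.
    by apply/andP; split; lra.
  have Gc : c <= G x.
    have /rD : ball x0 r x by rewrite /ball/= distrC; lra.
    by rewrite /= ler_norml /c => /andP[? ?]; lra.
  have -> : b x = y x by rewrite /b ger0_norm//; lra.
  apply: (@le_trans _ _ (c * (1 + y x *+ n))).
    rewrite [leRHS]mulrDr mulr1 -[y x *+ n]mulr_natl mulrA lerD2r; lra.
  apply: ler_pM => //; [exact: ltW|by rewrite addr_ge0// mulrn_wge0|].
  exact: bernoulli_ineq.
have cT n : continuous (fun x => G x * (1 + y x) ^+ n).
  apply: continuous_mul => //; elim: n => [|n IH].
    by move=> x; under eq_fun do rewrite expr0; exact: cvg_cst.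
  under eq_fun do rewrite exprS; apply: continuous_mul => //.
  by apply: continuous_add => //; exact: continuous_cst.
have ub n : (c * int1 b) * n%:R <= M * (2 * pi).
  rewrite -subr_ge0 -oppr_le0 opprB.
  have := int1_le _ (cT n) (lower n); rewrite HG.
  have c1 : continuous (fun x => c * n%:R * b x) by exact: continuous_scale.
  rewrite int1D//; last exact: continuous_cst.
  rewrite int1_cst int1Z// => H; rewrite mulrAC -mulNr addrC; apply: H.
  by apply: continuous_add => //; exact: continuous_cst.
have k0 : 0 < c * int1 b by rewrite mulr_gt0.
pose B := M * (2 * pi) / (c * int1 b).
have := ub (Num.bound `|B|).
rewrite mulrC -ler_pdivlMr// -/B; apply/negP; rewrite -ltNge.
by apply: le_lt_trans (ler_norm B) _; rewrite archi_boundP.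
Qed.

End Positivity.

Section ComplexTorusIntegral.
Context {R : realType}.

(** Stated on real and imaginary parts, as integrals and derivatives are, so that no topology on
    [R[i]] intervenes. *)
Definition ccontinuous (T : topologicalType) (f : T -> R[i]) : Prop :=
  continuous (fun x => complex.Re (f x)) /\ continuous (fun x => complex.Im (f x)).

Lemma ccontinuous_cst (T : topologicalType) c : ccontinuous (fun _ : T => c).
Proof. by split; exact: continuous_cst. Qed.

Lemma continuous_sub (T : topologicalType) (f g : T -> R) :
  continuous f -> continuous g -> continuous (fun x => f x - g x).
Proof. by move=> cf cg x; exact: cvgB (cf x) (cg x). Qed.

Lemma ccontinuousD (T : topologicalType) (f g : T -> R[i]) :
  ccontinuous f -> ccontinuous g -> ccontinuous (fun x => f x + g x).
Proof.
move=> [f1 f2] [g1 g2]; split; under eq_fun do rewrite (cReD, cImD);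
  exact: continuous_add.
Qed.

Lemma ccontinuousM (T : topologicalType) (f g : T -> R[i]) :
  ccontinuous f -> ccontinuous g -> ccontinuous (fun x => f x * g x).
Proof.
move=> [f1 f2] [g1 g2]; split.
  under eq_fun do rewrite cReM.
  by apply: continuous_sub; exact: continuous_mul.
under eq_fun do rewrite cImM.
by apply: continuous_add; exact: continuous_mul.
Qed.

Lemma ccontinuous_comp (T U : topologicalType) (f : T -> U) (g : U -> R[i]) :
  continuous f -> ccontinuous g -> ccontinuous (fun x => g (f x)).
Proof.
move=> cf [g1 g2]; split.
  exact: (continuous_compose cf g1).
exact: (continuous_compose cf g2).
Qed.

Lemma ccontinuous_sum (T : topologicalType) (I : Type) (s : seq I) (F : I -> T -> R[i]) :
  (forall i, ccontinuous (F i)) -> ccontinuous (fun x => \sum_(i <- s) F i x).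
Proof.
move=> cF; elim: s => [|i s IH].
  by under eq_fun do rewrite big_nil; exact: ccontinuous_cst.
by under eq_fun do rewrite big_cons; exact: ccontinuousD.
Qed.

Lemma expi_ccontinuous : ccontinuous (@expi R).
Proof. by split => x; [exact: continuous_cos|exact: continuous_sin]. Qed.

Definition cint1 (f : R -> R[i]) : R[i] :=
  int1 (fun x => complex.Re (f x)) +i* int1 (fun x => complex.Im (f x)).

Lemma cint1D f g : ccontinuous f -> ccontinuous g ->
  cint1 (fun x => f x + g x) = cint1 f + cint1 g.
Proof.
move=> [f1 f2] [g1 g2]; apply: complexP; rewrite ?cReD ?cImD /= -int1D//.
  by apply: eq_int1 => x; rewrite cReD.
by apply: eq_int1 => x; rewrite cImD.
Qed.

Lemma cint1Z c f : ccontinuous f -> cint1 (fun x => c * f x) = c * cint1 f.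
Proof.
move=> [f1 f2]; apply: complexP; rewrite ?cReM ?cImM /= -!int1Z//.
  rewrite -mulN1r -int1Z -?int1D//; try exact: continuous_scale.
    by apply: eq_int1 => x; rewrite cReM mulN1r.
  by apply: continuous_scale; exact: continuous_scale.
rewrite -int1D//; try exact: continuous_scale.
by apply: eq_int1 => x; rewrite cImM.
Qed.

Lemma torus_cintD N (f g : 'rV[R]_N -> R[i]) : ccontinuous f -> ccontinuous g ->
  torus_cint (fun x => f x + g x) = torus_cint f + torus_cint g.
Proof.
move=> [f1 f2] [g1 g2]; apply: complexP; rewrite ?cReD ?cImD /= -torus_intD//.
  by congr torus_int; apply/funext => x; rewrite /re cReD.
by congr torus_int; apply/funext => x; rewrite /im cImD.
Qed.

Lemma torus_cintZ N c (f : 'rV[R]_N -> R[i]) : ccontinuous f ->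
  torus_cint (fun x => c * f x) = c * torus_cint f.
Proof.
move=> [f1 f2]; apply: complexP; rewrite ?cReM ?cImM /= -!torus_intZ//.
  rewrite -mulN1r -torus_intZ -?torus_intD//; try exact: continuous_scale.
    by congr torus_int; apply/funext => x; rewrite /re cReM mulN1r.
  by apply: continuous_scale; exact: continuous_scale.
rewrite -torus_intD//; try exact: continuous_scale.
by congr torus_int; apply/funext => x; rewrite /im cImM.
Qed.

Lemma torus_cint0 N : torus_cint (fun _ : 'rV[R]_N => 0 : R[i]) = 0.
Proof. by apply: complexP; rewrite /= torus_int_cst mul0r. Qed.

Lemma torus_cint_sum N (I : Type) (s : seq I) (F : I -> 'rV[R]_N -> R[i]) :
  (forall i, ccontinuous (F i)) ->
  torus_cint (fun x => \sum_(i <- s) F i x) = \sum_(i <- s) torus_cint (F i).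
Proof.
move=> cF; elim: s => [|i s IH].
  by rewrite big_nil; under eq_fun do rewrite big_nil; exact: torus_cint0.
rewrite big_cons -IH -torus_cintD//; last exact: ccontinuous_sum.
by congr torus_cint; apply/funext => x; rewrite big_cons.
Qed.

(** Real and imaginary parts are bounded separately, whence the factor 2. *)
Lemma normc_torus_cint N (f : 'rV[R]_N -> R[i]) M : ccontinuous f ->
  (forall x, normc (f x) <= M) -> normc (torus_cint f) <= 2 * M * (2 * pi) ^+ N.
Proof.
move=> [f1 f2] fM; apply: le_trans (normc_le_ReIm _) _ => /=.
rewrite -mulrA mulr_natl mulr2n; apply: lerD.
  by apply: torus_int_abs => // x _; apply: le_trans (fM x); exact: Re_le_normc.
by apply: torus_int_abs => // x _; apply: le_trans (fM x); exact: Im_le_normc.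
Qed.

Lemma cslice_continuous N (f : 'rV[R]_N.+1 -> R[i]) x :
  ccontinuous f -> ccontinuous (slice f x).
Proof.
by move=> [/(@slice_continuous _ _ _ x) f1 /(@slice_continuous _ _ _ x) f2].
Qed.

Lemma cslice_int_continuous N (f : 'rV[R]_N.+1 -> R[i]) :
  ccontinuous f -> ccontinuous (fun x => torus_cint (slice f x)).
Proof.
move=> [f1 f2]; split; first exact: (slice_int_continuous f1).
exact: (slice_int_continuous f2).
Qed.

End ComplexTorusIntegral.

(** * Characters, and the vanishing of functions orthogonal to all of them *)

Section Characters.
Context {R : realType}.

Definition chr N (k : 'rV[int]_N) (x : 'rV[R]_N) : R[i] :=
  expi (\sum_i (k 0 i)%:~R * x 0 i).

Lemma normc_chr N (k : 'rV[int]_N) x : normc (chr k x) = 1.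
Proof. exact: normc_expi. Qed.

Lemma chrD N (k l : 'rV[int]_N) x : chr (k + l) x = chr k x * chr l x.
Proof.
rewrite /chr -expiD -big_split; congr expi; apply: eq_bigr => i _.
by rewrite mxE intrD mulrDl.
Qed.

Lemma chr0 N x : chr (0 : 'rV[int]_N) x = 1.
Proof. by rewrite /chr big1 ?expi0// => i _; rewrite mxE mul0r. Qed.

Lemma chr_shift N (k : 'rV[int]_N) (x v : 'rV[R]_N) : chr k (x + v) = chr k x * chr k v.
Proof.
rewrite /chr -expiD -big_split; congr expi; apply: eq_bigr => i _.
by rewrite mxE mulrDr.
Qed.

Lemma chr_delta N (k : 'rV[int]_N) i (h : R) :
  chr k (h *: delta_mx 0 i) = expi ((k 0 i)%:~R * h).
Proof.
rewrite /chr (bigD1 i)//= big1 ?addr0; first by rewrite !mxE !eqxx mulr1.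
by move=> j ji; rewrite !mxE (negbTE ji) /= !mulr0.
Qed.

Lemma linear_form_continuous N (c : 'I_N -> R) :
  continuous (fun x : 'rV[R]_N => \sum_i c i * x 0 i).
Proof.
elim: (index_enum _) => [|i s IH].
  by under eq_fun do rewrite big_nil; exact: continuous_cst.
under eq_fun do rewrite big_cons; apply: continuous_add => //.
by apply: continuous_scale; exact: coord_continuous.
Qed.

Lemma chr_ccontinuous N (k : 'rV[int]_N) : ccontinuous (chr k).
Proof.
exact: ccontinuous_comp (@linear_form_continuous N _) expi_ccontinuous.
Qed.

Lemma expi_int2pi (m : int) : expi (m%:~R * (2 * pi)) = 1 :> R[i].
Proof.
have E n : expi (n%:R * (2 * pi)) = 1 :> R[i].
  elim: n => [|n IH]; first by rewrite mul0r expi0.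
  rewrite -natr1 mulrDl mul1r expiD IH mul1r /expi mulr_natl cos2pi.
  by rewrite sin2pi.
case: m => n; first by rewrite -pmulrn E.
have /(congr1 (fun z => z * expi (- (n.+1%:R * (2 * pi))))) := E n.+1.
by rewrite -expiD subrr expi0 mul1r NegzE mulrNz mulNr -pmulrn => ->.
Qed.

Lemma chr_periodic N (k : 'rV[int]_N) : torus_periodic (chr k).
Proof. by move=> i x; rewrite chr_shift chr_delta expi_int2pi mulr1. Qed.

Definition kcons N (m : int) (k : 'rV[int]_N) : 'rV[int]_N.+1 :=
  \row_j oapp (k 0) m (unlift ord0 j).

Lemma chr_kcons N m (k : 'rV[int]_N) s (y : 'rV[R]_N) :
  chr (kcons m k) (cons_row s y) = expi (m%:~R * s) * chr k y.
Proof.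
rewrite /chr big_ord_recl expiD mxE unlift_none cons_row0; congr (_ * expi _).
by apply: eq_bigr => i _; rewrite mxE liftK /= cons_rowS.
Qed.

(** The kernel [T d] is a trigonometric polynomial with frequencies -1, 0 and 1, so multiplying by
    it preserves orthogonality to every character (the property [Z]), and so do its powers. Since
    [T d] is real, real and imaginary parts separate, and [peak_kernel_le0] is applied to each part
    and to its opposite. *)
Lemma cint1_uniq (h : R -> R[i]) (x0 : R) : ccontinuous h -> 0 < x0 < 2 * pi ->
  (forall m : int, cint1 (fun x => h x * expi (m%:~R * x)) = 0) -> h x0 = 0.
Proof.
move=> ch hx0 H0.
have cE (c : R) : ccontinuous (fun x : R => expi (c * x)).
  apply: (ccontinuous_comp _ expi_ccontinuous).
  by apply: continuous_scale => ?; exact: cvg_id.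
pose Z (F : R -> R[i]) := ccontinuous F /\
  forall m : int, cint1 (fun x => F x * expi (m%:~R * x)) = 0.
pose T (d x : R) : R := 1 + (cos (x - x0) - cos d).
have TE d x : (T d x)%:C = (1 - cos d)%:C + 2^-1%:C * expi (- x0) * expi (1%:~R * x)
    + 2^-1%:C * expi x0 * expi ((-1)%:~R * x).
  rewrite -!mulrA -!expiD.
  have -> : x0 + (-1)%:~R * x = - (x - x0) by rewrite mulrN1z mulN1r opprB.
  have -> : - x0 + 1%:~R * x = x - x0 by rewrite mul1r addrC.
  rewrite /expi cosN sinN /T; apply: complexP => /=; first by field.
  by ring.
have ZT F d : Z F -> Z (fun x => F x * (T d x)%:C).
  move=> [cF ZF]; split.
    under eq_fun do rewrite TE; apply: ccontinuousM => //.
    by repeat apply: ccontinuousD; do ?apply: ccontinuousM; try exact: ccontinuous_cst.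
  move=> m; have E x : F x * (T d x)%:C * expi (m%:~R * x) =
     (1 - cos d)%:C * (F x * expi (m%:~R * x)) +
     ((2^-1%:C * expi (- x0)) * (F x * expi ((m + 1)%:~R * x)) +
      (2^-1%:C * expi x0) * (F x * expi ((m - 1)%:~R * x))).
    by rewrite TE !intrD !mulrDl !expiD; ring.
  have cFm (k : int) : ccontinuous (fun x => F x * expi (k%:~R * x)).
    exact: ccontinuousM.
  have cFZ c (k : int) : ccontinuous (fun x => c * (F x * expi (k%:~R * x))).
    by apply: ccontinuousM => //; exact: ccontinuous_cst.
  under eq_fun do rewrite E.
  rewrite cint1D//; last exact: ccontinuousD.
  by rewrite cint1D// !cint1Z// !ZF !mulr0 !addr0.
have ZTn d n : Z (fun x => h x * (T d x ^+ n)%:C).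
  elim: n => [|n /(ZT _ d) IH]; first by under eq_fun do rewrite expr0 mulr1.
  by under eq_fun do rewrite exprSr rmorphM mulrA.
have K d n : cint1 (fun x => h x * (T d x ^+ n)%:C) = 0.
  have [_ /(_ 0)] := ZTn d n; under eq_fun do rewrite mul0r expi0 mulr1.
  exact.
have R0 d n : int1 (fun x => complex.Re (h x) * T d x ^+ n) = 0.
  have /(congr1 (@complex.Re R))/= := K d n.
  by under eq_fun do rewrite cReM/= mulr0 subr0.
have I0 d n : int1 (fun x => complex.Im (h x) * T d x ^+ n) = 0.
  have /(congr1 (@complex.Im R))/= := K d n.
  by under eq_fun do rewrite cImM/= mulr0 add0r.
have main (G : R -> R) : continuous G ->
    (forall d n, int1 (fun x => G x * T d x ^+ n) = 0) -> G x0 = 0.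
  move=> cG G0; apply/eqP; rewrite eq_le; apply/andP; split.
    exact: peak_kernel_le0 hx0 G0.
  rewrite -oppr_le0 -mulN1r; apply: (@peak_kernel_le0 _ (fun x => -1 * G x) x0 _ hx0).
    exact: continuous_scale.
  move=> d n; under eq_fun do rewrite -mulrA.
  rewrite int1Z ?G0 ?mulr0//; apply: continuous_mul => //.
  have cT : continuous (T d).
    apply: continuous_add; first exact: continuous_cst.
    apply: continuous_sub; last exact: continuous_cst.
    apply: (continuous_compose _ (@continuous_cos R)).
    by apply: continuous_sub; [by move=> ?; exact: cvg_id|exact: continuous_cst].
  elim: n => [|n IH]; first by under eq_fun do rewrite expr0; exact: continuous_cst.
  by under eq_fun do rewrite exprS; exact: continuous_mul.
by case: ch => c1 c2; apply: complexP; [exact: main c1 R0|exact: main c2 I0].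
Qed.

(** For fixed frequencies in the remaining variables, the slice integral is a function of the first
    variable orthogonal to all characters, hence zero at [x 0 ord0]; the slice itself then falls
    under the induction hypothesis. Only interior points are reached here, because [cint1_uniq]
    needs room around the peak. *)
Lemma torus_cint_uniq_box N (f : 'rV[R]_N -> R[i]) (x : 'rV[R]_N) :
  ccontinuous f -> (forall k, torus_cint (fun x => f x * chr k x) = 0) ->
  (forall i, 0 < x 0 i < 2 * pi) -> f x = 0.
Proof.
elim: N f x => [|N IH] f x cf f0 hx.
  have := f0 0; rewrite /torus_cint /= /re /im chr0 mulr1 => E.
  have -> : x = 0 by apply/rowP => -[].
  by case: (f 0) E.
pose y : 'rV[R]_N := \row_j x 0 (lift ord0 j).
have -> : x = cons_row (x 0 ord0) y.
  apply/rowP => j; case: (unliftP ord0 j) => [m|] ->; last by rewrite cons_row0.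
  by rewrite cons_rowS mxE.
apply: (IH (slice f (x 0 ord0)) y).
- exact: cslice_continuous.
- move=> k.
  pose h (s : R) := torus_cint (fun y => slice f s y * chr k y).
  have hE s : h s = torus_cint (slice (fun z => f z * chr (kcons 0 k) z) s).
    congr torus_cint; apply/funext => z.
    by rewrite /slice chr_kcons mul0r expi0 mul1r.
  apply: (@cint1_uniq h) (hx ord0) _.
    rewrite (funext hE); apply: cslice_int_continuous.
    by apply: ccontinuousM => //; exact: chr_ccontinuous.
  move=> m; have := f0 (kcons m k).
  rewrite /torus_cint /cint1 => E; rewrite -[RHS]E; congr (_ +i* _).
    rewrite /re torus_intS; apply: eq_int1 => s.
    rewrite mulrC -torus_cintZ /torus_cint/=; last first.
      by apply: ccontinuousM; [exact: cslice_continuous|exact: chr_ccontinuous].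
    congr torus_int; apply/funext => z; rewrite /re /slice chr_kcons.
    by rewrite mulrCA.
  rewrite /im torus_intS; apply: eq_int1 => s.
  rewrite mulrC -torus_cintZ /torus_cint/=; last first.
    by apply: ccontinuousM; [exact: cslice_continuous|exact: chr_ccontinuous].
  congr torus_int; apply/funext => z; rewrite /im /slice chr_kcons.
  by rewrite mulrCA.
- by move=> i; rewrite mxE; exact: hx.
Qed.

End Characters.

(** * Absolutely convergent sums over the lattice of frequencies *)

Section LatticeSums.
Context {R : realType}.

Lemma ler_sum_uniq_sub (T : eqType) (s t : seq T) (F : T -> R) :
  (forall x, 0 <= F x) -> uniq s -> {subset s <= t} ->
  \sum_(x <- s) F x <= \sum_(x <- t) F x.
Proof.
move=> F0; elim: s t => [|x s IH] t.
  by rewrite big_nil => _ _; exact: sumr_ge0.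
move=> /= /andP[xs us] st; have xt : x \in t by apply: st; rewrite inE eqxx.
rewrite (perm_big _ (perm_to_rem xt)) !big_cons lerD2l; apply: IH => // y ys.
have := st y; rewrite inE ys orbT => /(_ isT).
rewrite (perm_mem (perm_to_rem xt)) inE => /orP[/eqP yx|//].
by rewrite yx (negbTE xs) in ys.
Qed.

Lemma inv_sqr_sum_nat (s : seq nat) : uniq s ->
  \sum_(n <- s) (1 + n%:R : R) ^- 2 <= 2.
Proof.
move=> us; pose M := (\max_(n <- s) n).+1.
have sM : {subset s <= index_iota 0 M}.
  by move=> n ns; rewrite mem_index_iota /= ltnS; exact: leq_bigmax_seq.
have F0 n : 0 <= (1 + n%:R : R) ^- 2 by rewrite invr_ge0 exprn_ge0// addr_ge0.
apply: le_trans (ler_sum_uniq_sub F0 us sM) _.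
(* Telescoping: [(1 + m)^-2] is at most [2 / (1 + m) - 2 / (2 + m)]. *)
suff H m : \sum_(0 <= n < m) (1 + n%:R : R) ^- 2 <= 2 - 2 / (1 + m%:R).
  by apply: le_trans (H M) _; rewrite gerBl divr_ge0// addr_ge0.
elim: m => [|m IH]; first by rewrite big_nil addr0 divr1 subrr.
rewrite big_nat_recr//= -[m.+1%:R]natr1.
have m0 : 0 <= m%:R :> R by [].
have E : (1 + m%:R : R) ^- 2 <= 2 / (1 + m%:R) - 2 / (1 + (m%:R + 1)).
  move: (m%:R : R) m0 => x x0.
  have -> : 2 / (1 + x) - 2 / (1 + (x + 1)) = (2 * (1 + x) / (2 + x)) * (1 + x) ^- 2.
    by field; apply/andP; split; rewrite gt_eqF//; lra.
  have x2 : 0 < 2 + x by lra.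
  apply: ler_peMl; first by rewrite invr_ge0 exprn_ge0//; lra.
  by rewrite ler_pdivlMr// mul1r mulrDr mulr1 lerD2l ler_peMl// ler1n.
by apply: le_trans (lerD IH E) _; lra.
Qed.

(** The zigzag numbering of the integers; [1 + nat_of_int b <= 2 (1 + |b|)], whence the factor 4
    between inverse squares. *)
Definition nat_of_int (b : int) : nat :=
  match b with Posz n => n.*2 | Negz n => n.*2.+1 end.

Lemma nat_of_int_inj : injective nat_of_int.
Proof.
move=> [m|m] [n|n] /=.
- by move/(congr1 half); rewrite !doubleK => ->.
- by move/(congr1 odd); rewrite /= !odd_double.
- by move/(congr1 odd); rewrite /= !odd_double.
- by move=> [] /(congr1 half); rewrite !doubleK => ->.
Qed.

Lemma inv_sqr_int (b : int) :
  (1 + `|b%:~R| : R) ^- 2 <= 4 * (1 + (nat_of_int b)%:R) ^- 2.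
Proof.
have K (x y : R) : 0 < x -> 0 < y -> y <= 2 * x -> x ^- 2 <= 4 * y ^- 2.
  move=> x0 y0 yx; rewrite -[4](_ : 2 ^+ 2 = _); last by rewrite -natrX.
  rewrite -exprVn -exprVn -exprMn ler_pXn2r ?nnegrE ?invr_ge0 ?mulr_ge0 ?(ltW y0) ?(ltW x0)//.
    by rewrite ler_pdivlMr// mulrC ler_pdivrMr.
  by rewrite invr_ge0 ltW.
apply: K; rewrite ?ltr_wpDr//.
case: b => n.
  rewrite -pmulrn ger0_norm// /= -muln2 natrM; have : 0 <= n%:R :> R by []. lra.
rewrite NegzE mulrNz -pmulrn normrN ger0_norm// /= -natr1 -muln2 natrM -natr1.
have : 0 <= n%:R :> R by []. lra.
Qed.

Lemma inv_sqr_sum_int (s : seq int) : uniq s ->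
  \sum_(b <- s) (1 + `|b%:~R| : R) ^- 2 <= 8.
Proof.
move=> us.
apply: (@le_trans _ _ (\sum_(b <- s) 4 * (1 + (nat_of_int b)%:R : R) ^- 2)).
  by apply: ler_sum => b _; exact: inv_sqr_int.
rewrite -mulr_sumr -(big_map nat_of_int xpredT (fun n => (1 + n%:R : R) ^- 2)).
rewrite [leRHS](_ : 8 = 4 * 2); last by rewrite -natrM.
rewrite ler_pM2l//; apply: inv_sqr_sum_nat.
by rewrite map_inj_uniq//; exact: nat_of_int_inj.
Qed.

(** The finite set [s] lies in a product [B^N], where [B] collects all coordinates occurring in [s];
    over the product the sum factors into [N] one-dimensional sums, each at most 8. *)
Lemma inv_sqr_sum_lattice N (s : seq 'rV[int]_N) : uniq s ->
  \sum_(k <- s) \prod_i (1 + `|(k 0 i)%:~R| : R) ^- 2 <= 8 ^+ N.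
Proof.
move=> us.
pose B := undup [seq (k : 'rV[int]_N) 0 i | k <- s, i <- enum 'I_N].
have BP (k : 'rV[int]_N) i : k \in s -> k 0 i \in B.
  by move=> ks; rewrite mem_undup; apply/allpairsP; exists (k, i); rewrite mem_enum.
pose V (f : {ffun 'I_N -> 'I_(size B)}) : 'rV[int]_N := \row_i B`_(f i).
have w0 b : 0 <= (1 + `|b%:~R| : R) ^- 2 by rewrite invr_ge0 exprn_ge0// addr_ge0.
have F0 (k : 'rV[int]_N) : 0 <= \prod_i (1 + `|(k 0 i)%:~R| : R) ^- 2.
  exact: prodr_ge0.
have sub : {subset s <= [seq V f | f <- enum {: {ffun 'I_N -> 'I_(size B)}}]}.
  move=> k ks; have H i : (index (k 0%R i) B < size B)%N by rewrite index_mem BP.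
  apply/mapP; exists [ffun i => Ordinal (H i)]; first by rewrite mem_enum.
  by apply/rowP => i; rewrite mxE ffunE /= nth_index// BP.
apply: le_trans (ler_sum_uniq_sub F0 us sub) _.
rewrite big_map big_enum/=.
under eq_bigr do under eq_bigr do rewrite mxE.
rewrite -(bigA_distr_bigA (fun i (j : 'I_(size B)) => (1 + `|(B`_j)%:~R| : R) ^- 2)).
rewrite -[in leRHS](card_ord N) -prodr_const; apply: ler_prod => i _.
apply/andP; split; first exact: sumr_ge0.
rewrite -(big_mkord xpredT (fun j => (1 + `|(B`_j)%:~R| : R) ^- 2)).
rewrite -(big_nth 0 xpredT (fun b => (1 + `|b%:~R| : R) ^- 2)).
by apply: inv_sqr_sum_int; exact: undup_uniq.
Qed.

Definition knorm N (k : 'rV[int]_N) : R := \sum_i `|(k 0 i)%:~R|.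

Lemma knorm_ge0 N (k : 'rV[int]_N) : 0 <= knorm k.
Proof. exact: sumr_ge0. Qed.

Lemma knormP1_gt0 N (k : 'rV[int]_N) : 0 < 1 + knorm k.
Proof. by rewrite ltr_wpDr// knorm_ge0. Qed.

Lemma coord_le_knorm N (k : 'rV[int]_N) i : `|(k 0 i)%:~R| <= knorm k.
Proof. by rewrite /knorm (bigD1 i)//= lerDl; exact: sumr_ge0. Qed.

Lemma knormD N (k l : 'rV[int]_N) : knorm (k + l) <= knorm k + knorm l.
Proof.
rewrite /knorm -big_split; apply: ler_sum => i _.
by rewrite mxE intrD; exact: ler_normD.
Qed.

Lemma knormN N (k : 'rV[int]_N) : knorm (- k) = knorm k.
Proof. by apply: eq_bigr => i _; rewrite mxE mulrNz normrN. Qed.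

(** The summable weight against which all series are dominated; the exponent [2 N] leaves an inverse
    square for each coordinate. *)
Definition wt N (k : 'rV[int]_N) : R := (1 + knorm k) ^- N.*2.

Lemma wt_gt0 N (k : 'rV[int]_N) : 0 < wt k.
Proof. by rewrite invr_gt0 exprn_gt0// knormP1_gt0. Qed.

Lemma wt_le_prod N (k : 'rV[int]_N) : wt k <= \prod_i (1 + `|(k 0 i)%:~R| : R) ^- 2.
Proof.
rewrite prodfV lef_pV2 ?posrE ?exprn_gt0 ?knormP1_gt0//; last first.
  by apply: prodr_gt0 => i _; rewrite exprn_gt0// ltr_wpDr.
rewrite -muln2 mulnC exprM -[X in _ ^+ X](card_ord N) -prodr_const.
apply: ler_prod => i _; rewrite exprn_ge0 ?addr_ge0//=.
by rewrite ler_pXn2r ?nnegrE ?addr_ge0 ?knorm_ge0// lerD2l coord_le_knorm.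
Qed.

(** Frequencies are ordered by their [pickle] code, not by size: every series is absolutely
    dominated, so any exhaustion by finite sets will do. *)
Definition lattice_enum N (J : nat) : seq 'rV[int]_N := pmap pickle_inv (iota 0 J).

Lemma lattice_enum_uniq N J : uniq (@lattice_enum N J).
Proof.
apply: (pmap_uniq (g := pickle)); last exact: iota_uniq.
by move=> n; exact: pickle_invK.
Qed.

Lemma mem_lattice_enum N J (k : 'rV[int]_N) : (k \in lattice_enum N J) = (pickle k < J)%N.
Proof.
apply/idP/idP.
  rewrite mem_pmap => /mapP[n]; rewrite mem_iota add0n => /andP[_ nJ] E.
  by have := @pickle_invK ('rV[int]_N : countType) n; rewrite -E /= => ->.
move=> kJ; rewrite mem_pmap; apply/mapP; exists (pickle k); first by rewrite mem_iota.
by rewrite pickleK_inv.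
Qed.

Definition psum (V : zmodType) N (c : 'rV[int]_N -> V) (J : nat) : V :=
  \sum_(k <- lattice_enum N J) c k.

Lemma lattice_enum_cat N (J K : nat) : (J <= K)%N ->
  lattice_enum N K = lattice_enum N J ++ pmap pickle_inv (iota J (K - J)).
Proof. by move=> JK; rewrite /lattice_enum -[in LHS](subnKC JK) iotaD pmap_cat. Qed.

Lemma psumB_le N (c d : 'rV[int]_N -> R) J K : (J <= K)%N ->
  (forall k, `|c k| <= d k) -> `|psum c K - psum c J| <= psum d K - psum d J.
Proof.
move=> JK cd; rewrite /psum (lattice_enum_cat N JK) !big_cat/=.
rewrite [X in `|X|]addrAC subrr add0r [leRHS]addrAC subrr add0r.
by apply: le_trans (ler_norm_sum _ _ _) _; exact: ler_sum.
Qed.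

Lemma psum_nd N (d : 'rV[int]_N -> R) : (forall k, 0 <= d k) ->
  nondecreasing_seq (psum d).
Proof.
move=> d0 J K JK; rewrite -subr_ge0; apply: le_trans (psumB_le JK _); first exact: normr_ge0.
by move=> k; rewrite ger0_norm.
Qed.

Lemma psumD (V : zmodType) N (c d : 'rV[int]_N -> V) J :
  psum (fun k => c k + d k) J = psum c J + psum d J.
Proof. exact: big_split. Qed.

Lemma psumZ (V : comPzRingType) N x (c : 'rV[int]_N -> V) J :
  psum (fun k => x * c k) J = x * psum c J.
Proof. by rewrite /psum mulr_sumr. Qed.

Lemma psum_wt_le N J : psum (@wt N) J <= 8 ^+ N.
Proof.
apply: le_trans (inv_sqr_sum_lattice (@lattice_enum_uniq N J)).
by apply: ler_sum => k _; exact: wt_le_prod.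
Qed.

Lemma psum_dominated_cvg N (c : 'rV[int]_N -> R) A :
  (forall k, `|c k| <= A * wt k) -> cvgn (psum c).
Proof.
move=> cA.
have A0 : 0 <= A by rewrite -(pmulr_lge0 A (wt_gt0 (0 : 'rV[int]_N))); exact: le_trans (cA 0).
have H : forall (d : 'rV[int]_N -> R) B, 0 <= B -> (forall k, 0 <= d k <= B * wt k) ->
    cvgn (psum d).
  move=> d B B0 dB; apply: nondecreasing_is_cvgn.
    by apply: psum_nd => k; case/andP: (dB k).
  exists (B * 8 ^+ N) => _ [J _ <-]; apply: le_trans (_ : psum (fun k : 'rV[int]_N => B * wt k) J <= _).
    by apply: ler_sum => k _; case/andP: (dB k).
  by rewrite psumZ ler_wpM2l// psum_wt_le.
(* [c + A wt] and [A wt] are nonnegative, so each has monotone bounded partial sums. *)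
have -> : psum c = psum (fun k => c k + A * wt k) - psum (fun k : 'rV[int]_N => A * wt k).
  by apply/funext => J; rewrite -[RHS]/(psum _ J - psum _ J) psumD addrK.
apply: is_cvgB.
  apply: (H _ (A + A)); first exact: addr_ge0.
  by move=> k; have := cA k; rewrite ler_norml mulrDl => /andP[? ?]; apply/andP; split; lra.
by apply: (H _ A) => // k; rewrite lexx mulr_ge0// ltW// wt_gt0.
Qed.

(** One null sequence that measures the truncation error of every series, up to a constant. *)
Definition tail N J : R := limn (psum (@wt N)) - psum (@wt N) J.

Lemma psum_wt_cvg N : cvgn (psum (@wt N)).
Proof.
apply: (@psum_dominated_cvg _ _ 1) => k; rewrite mul1r ger0_norm//.
exact/ltW/wt_gt0.
Qed.

Lemma tail_ge0 N J : 0 <= tail N J.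
Proof.
rewrite subr_ge0; apply: (nondecreasing_cvgn_le _ (@psum_wt_cvg N)).
by apply: psum_nd => k; exact/ltW/wt_gt0.
Qed.

Lemma tail_cvg0 N : tail N @ \oo --> (0 : R).
Proof.
rewrite -(subrr (limn (psum (@wt N)))).
by apply: cvgB; [exact: cvg_cst|exact: psum_wt_cvg].
Qed.

Lemma tail_small N (B e : R) : 0 < e -> exists J0, forall J, (J0 <= J)%N -> B * tail N J <= e.
Proof.
move=> e0; have : (fun J => B * tail N J) @ \oo --> B * 0.
  by apply: cvgM; [exact: cvg_cst|exact: tail_cvg0].
rewrite mulr0 => /cvgrPdist_le/(_ e e0)[J0 _ H]; exists J0 => J /H.
by rewrite /= sub0r normrN => /(le_trans (ler_norm _)).
Qed.

Lemma limn_psum_tail N (c : 'rV[int]_N -> R) A J :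
  (forall k, `|c k| <= A * wt k) -> `|limn (psum c) - psum c J| <= A * tail N J.
Proof.
move=> cA.
have A0 : 0 <= A by rewrite -(pmulr_lge0 A (wt_gt0 (0 : 'rV[int]_N))); exact: le_trans (cA 0).
have cc := psum_dominated_cvg cA.
have H : (fun K => `|psum c K - psum c J|) @ \oo --> `|limn (psum c) - psum c J|.
  by apply: cvg_norm; apply: cvgB => //; exact: cvg_cst.
rewrite -(cvg_lim _ H)//; apply: limr_le; first by apply/cvg_ex; eexists; exact: H.
exists J => // K /= JK; apply: le_trans (psumB_le JK cA) _.
rewrite !psumZ -mulrBr ler_wpM2l// lerD2r.
apply: (nondecreasing_cvgn_le _ (@psum_wt_cvg N)).
by apply: psum_nd => k; exact/ltW/wt_gt0.
Qed.

(* Meaningful only for families dominated by a multiple of [wt]. *)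
Definition lsum N (c : 'rV[int]_N -> R[i]) : R[i] :=
  limn (psum (fun k => complex.Re (c k))) +i* limn (psum (fun k => complex.Im (c k))).

Lemma lsum_tail N (c : 'rV[int]_N -> R[i]) A J :
  (forall k, normc (c k) <= A * wt k) -> normc (lsum c - psum c J) <= 2 * A * tail N J.
Proof.
move=> cA; apply: le_trans (normc_le_ReIm _) _.
rewrite cReD cImD cReN cImN /psum cRe_sum cIm_sum -mulrA mulr_natl mulr2n.
apply: lerD; apply: limn_psum_tail => k; apply: le_trans (cA k).
  exact: Re_le_normc.
exact: Im_le_normc.
Qed.

Lemma eq_of_tail N (z w : R[i]) B :
  (forall J, normc (z - w) <= B * tail N J) -> z = w.
Proof.
move=> H; apply/eqP; rewrite -subr_eq0; apply/eqP/normc_eq0P.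
apply/ler_addgt0Pr => e e0; rewrite add0r.
by have [J0 /(_ J0 (leqnn _))] := tail_small N B e0; exact: le_trans (H J0).
Qed.

(** The way sums are identified throughout: to show that an operation commutes with a sum, bound its
    effect on the truncation error by a multiple of [tail]. Linearity, termwise integration and the
    action of distributions all follow this pattern. *)
Lemma lsum_eq N (c : 'rV[int]_N -> R[i]) A z B :
  (forall k, normc (c k) <= A * wt k) ->
  (forall J, normc (z - psum c J) <= B * tail N J) -> z = lsum c.
Proof.
move=> cA zB; apply: (@eq_of_tail N _ _ (B + 2 * A)) => J.
rewrite (_ : z - lsum c = (z - psum c J) - (lsum c - psum c J)); last by ring.
apply: le_trans (normcD _ _) _; rewrite normc_opp mulrDl; apply: lerD => //.
exact: lsum_tail.
Qed.

Lemma normc_lsum N (c : 'rV[int]_N -> R[i]) A :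
  (forall k, normc (c k) <= A * wt k) -> normc (lsum c) <= 2 * A * tail N 0.
Proof.
move=> cA; have := lsum_tail 0 cA.
by rewrite {1}/psum /lattice_enum /= big_nil subr0.
Qed.

Lemma lsumD N (c d : 'rV[int]_N -> R[i]) A B :
  (forall k, normc (c k) <= A * wt k) -> (forall k, normc (d k) <= B * wt k) ->
  lsum (fun k => c k + d k) = lsum c + lsum d.
Proof.
move=> cA dB; symmetry; apply: (@lsum_eq _ _ (A + B) _ (2 * A + 2 * B)).
  by move=> k; rewrite mulrDl; apply: le_trans (normcD _ _) (lerD _ _).
move=> J; rewrite psumD opprD addrACA mulrDl.
apply: le_trans (normcD _ _) _; apply: lerD; exact: lsum_tail.
Qed.

Lemma lsumZ N z (c : 'rV[int]_N -> R[i]) A :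
  (forall k, normc (c k) <= A * wt k) ->
  lsum (fun k => z * c k) = z * lsum c.
Proof.
move=> cA; symmetry; apply: (@lsum_eq _ _ (normc z * A) _ (normc z * (2 * A))).
  by move=> k; rewrite normcM -mulrA ler_wpM2l ?normc_ge0.
move=> J; rewrite psumZ -mulrBr normcM -mulrA ler_wpM2l ?normc_ge0//.
exact: lsum_tail.
Qed.

End LatticeSums.

(** * Smooth functions *)

Section SmoothAlgebra.
Context {R : realType} {N : nat}.
Implicit Types (f g : 'rV[R]_N -> R) (F G : 'rV[R]_N -> R[i]).

(** Smoothness quantifies over all iterated partials; it suffices to find a class of continuous,
    differentiable functions stable under every first-order partial. *)
Lemma smooth_coind (P : ('rV[R]_N -> R) -> Prop) :
  (forall f, P f -> [/\ continuous f,
     (forall i x, derivable f x (delta_mx 0 i)) & forall i, P (partial i f)]) ->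
  forall f, P f -> smooth f.
Proof.
move=> H f Pf l.
suff Pl : P (partials l f) by have [] := H _ Pl.
by elim: l => [//|i l IH]; have [_ _] := H _ IH; exact.
Qed.

Lemma smooth_continuous f : smooth f -> continuous f.
Proof. by move=> /(_ [::])[]. Qed.

Lemma smooth_derivable f i x : smooth f -> derivable f x (delta_mx 0 i).
Proof. by move=> /(_ [::])[]. Qed.

Lemma smooth_partial f i : smooth f -> smooth (partial i f).
Proof.
move=> sf l; have -> : partials l (partial i f) = partials (rcons l i) f.
  by rewrite /partials foldr_rcons.
exact: sf.
Qed.

Lemma partialD f g i : (forall x, derivable f x (delta_mx 0 i)) ->
  (forall x, derivable g x (delta_mx 0 i)) ->
  partial i (fun x => f x + g x) = fun x => partial i f x + partial i g x.
Proof. by move=> df dg; apply/funext => x; exact: deriveD. Qed.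

Lemma partialM f g i : (forall x, derivable f x (delta_mx 0 i)) ->
  (forall x, derivable g x (delta_mx 0 i)) ->
  partial i (fun x => f x * g x) =
  fun x => f x * partial i g x + g x * partial i f x.
Proof. by move=> df dg; apply/funext => x; exact: deriveM. Qed.

(** The partial of a product is a sum of products, so products alone are not stable under
    differentiation; the algebra generated by smooth functions is. *)
Inductive smooth_alg : ('rV[R]_N -> R) -> Prop :=
| SmoothBase f : smooth f -> smooth_alg f
| SmoothAdd f g : smooth_alg f -> smooth_alg g -> smooth_alg (fun x => f x + g x)
| SmoothMul f g : smooth_alg f -> smooth_alg g -> smooth_alg (fun x => f x * g x).

Lemma smooth_alg_smooth f : smooth_alg f -> smooth f.
Proof.
apply: smooth_coind => {}f; elim=> {f} [f sf|f g af [cf df pf] ag [cg dg pg]|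
  f g af [cf df pf] ag [cg dg pg]].
- split; first exact: smooth_continuous.
    by move=> i x; exact: smooth_derivable.
  by move=> i; apply: SmoothBase; exact: smooth_partial.
- split; first exact: continuous_add.
    by move=> i x; exact: derivableD.
  by move=> i; rewrite partialD//; exact: SmoothAdd.
- split; first exact: continuous_mul.
    by move=> i x; exact: derivableM.
  by move=> i; rewrite partialM//; apply: SmoothAdd; exact: SmoothMul.
Qed.

Lemma smoothD f g : smooth f -> smooth g -> smooth (fun x => f x + g x).
Proof. by move=> sf sg; apply: smooth_alg_smooth; apply: SmoothAdd; exact: SmoothBase. Qed.

Lemma smoothM f g : smooth f -> smooth g -> smooth (fun x => f x * g x).
Proof. by move=> sf sg; apply: smooth_alg_smooth; apply: SmoothMul; exact: SmoothBase. Qed.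

Lemma partial_cst c i : partial i (fun _ : 'rV[R]_N => c) = fun=> 0.
Proof. by apply/funext => x; exact: derive_cst. Qed.

Lemma smooth_cst c : smooth (fun _ : 'rV[R]_N => c).
Proof.
apply: (@smooth_coind (fun f => exists c, f = fun=> c)); last by exists c.
move=> _ [d ->]; split; first exact: continuous_cst.
  by move=> i x; exact: derivable_cst.
by move=> i; exists 0; exact: partial_cst.
Qed.

Definition csmooth F : Prop := smooth (re F) /\ smooth (im F).

Lemma csmooth_coind (P : ('rV[R]_N -> R[i]) -> Prop) :
  (forall F, P F -> [/\ ccontinuous F,
     (forall i x, derivable (re F) x (delta_mx 0 i) /\ derivable (im F) x (delta_mx 0 i))
     & forall i, P (cpartial i F)]) ->
  forall F, P F -> csmooth F.
Proof.
move=> H F PF; split.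
  apply: (@smooth_coind (fun f => exists2 G, P G & f = re G)); last by exists F.
  move=> _ [G PG ->]; have [[c1 c2] d p] := H _ PG; split => //.
    by move=> i x; case: (d i x).
  by move=> i; exists (cpartial i G).
apply: (@smooth_coind (fun f => exists2 G, P G & f = im G)); last by exists F.
move=> _ [G PG ->]; have [[c1 c2] d p] := H _ PG; split => //.
  by move=> i x; case: (d i x).
by move=> i; exists (cpartial i G).
Qed.

Lemma csmooth_continuous F : csmooth F -> ccontinuous F.
Proof. by move=> [sr si]; split; exact: smooth_continuous. Qed.

Lemma csmooth_cpartial F i : csmooth F -> csmooth (cpartial i F).
Proof. by move=> [sr si]; split; exact: smooth_partial. Qed.

Lemma csmooth_cpartials F l : csmooth F -> csmooth (cpartials l F).
Proof. by move=> sF; elim: l => [//|i l IH]; exact: csmooth_cpartial. Qed.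

Lemma csmooth_cst c : csmooth (fun=> c).
Proof. by split; exact: smooth_cst. Qed.

Lemma csmoothD F G : csmooth F -> csmooth G -> csmooth (fun x => F x + G x).
Proof.
move=> [Fr Fi] [Gr Gi]; split.
  rewrite (_ : re _ = fun x => re F x + re G x); first exact: smoothD.
  by apply/funext => x; exact: cReD.
rewrite (_ : im _ = fun x => im F x + im G x); first exact: smoothD.
by apply/funext => x; exact: cImD.
Qed.

Lemma re_mulE F G : re (fun x => F x * G x) =
  fun x => re F x * re G x + -1 * (im F x * im G x).
Proof. by apply/funext => x; rewrite mulN1r; exact: cReM. Qed.

Lemma im_mulE F G : im (fun x => F x * G x) =
  fun x => re F x * im G x + im F x * re G x.
Proof. by apply/funext => x; exact: cImM. Qed.

Lemma csmoothM F G : csmooth F -> csmooth G -> csmooth (fun x => F x * G x).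
Proof.
move=> [Fr Fi] [Gr Gi]; split.
  rewrite re_mulE; apply: smoothD; first exact: smoothM.
  by apply: smoothM; [exact: smooth_cst|exact: smoothM].
by rewrite im_mulE; apply: smoothD; exact: smoothM.
Qed.

Lemma csmooth_sum (I : Type) (s : seq I) (F : I -> 'rV[R]_N -> R[i]) :
  (forall i, csmooth (F i)) -> csmooth (fun x => \sum_(i <- s) F i x).
Proof.
move=> cF; elim: s => [|i s IH].
  by under eq_fun do rewrite big_nil; exact: csmooth_cst.
by under eq_fun do rewrite big_cons; exact: csmoothD.
Qed.

Lemma csmooth_real f : smooth f -> csmooth (fun x => (f x)%:C).
Proof. by move=> sf; split=> //; exact: smooth_cst. Qed.

Lemma cpartialD F G i : csmooth F -> csmooth G ->
  cpartial i (fun x => F x + G x) = fun x => cpartial i F x + cpartial i G x.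
Proof.
move=> [Fr Fi] [Gr Gi]; apply/funext => x; apply: complexP; rewrite ?cReD ?cImD /=.
  rewrite (_ : re _ = fun x => re F x + re G x); last by apply/funext => y; exact: cReD.
  by rewrite partialD// => y; exact: smooth_derivable.
rewrite (_ : im _ = fun x => im F x + im G x); last by apply/funext => y; exact: cImD.
by rewrite partialD// => y; exact: smooth_derivable.
Qed.

Lemma cpartialM F G i : csmooth F -> csmooth G ->
  cpartial i (fun x => F x * G x) =
  fun x => cpartial i F x * G x + F x * cpartial i G x.
Proof.
move=> [Fr Fi] [Gr Gi]; apply/funext => x.
have FGi : smooth (fun x => im F x * im G x) by exact: smoothM.
have m1 : smooth (fun _ : 'rV[R]_N => -1 : R) by exact: smooth_cst.
apply: complexP; rewrite ?cReD ?cImD ?cReM ?cImM /=.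
  rewrite re_mulE partialD; first last.
    by move=> y; apply: smooth_derivable; exact: smoothM.
    by move=> y; apply: smooth_derivable; exact: smoothM.
  rewrite !partialM; try by move=> y; exact: smooth_derivable.
  by rewrite partial_cst /re /im; ring.
rewrite im_mulE partialD; first last.
  by move=> y; apply: smooth_derivable; exact: smoothM.
  by move=> y; apply: smooth_derivable; exact: smoothM.
rewrite !partialM; try by move=> y; exact: smooth_derivable.
by rewrite /re /im; ring.
Qed.

Lemma cpartial_cst c i : cpartial i (fun _ : 'rV[R]_N => c) = fun=> 0.
Proof.
by apply/funext => x; apply: complexP => /=; rewrite /re /im partial_cst.
Qed.

Lemma cpartialZ c F i : csmooth F ->
  cpartial i (fun x => c * F x) = fun x => c * cpartial i F x.
Proof.
move=> sF; rewrite cpartialM//; last exact: csmooth_cst.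
by rewrite cpartial_cst; apply/funext => x; rewrite mul0r add0r.
Qed.

Lemma cpartial_sum (I : Type) (s : seq I) (F : I -> 'rV[R]_N -> R[i]) i :
  (forall j, csmooth (F j)) ->
  cpartial i (fun x => \sum_(j <- s) F j x) = fun x => \sum_(j <- s) cpartial i (F j) x.
Proof.
move=> sF; elim: s => [|j s IH].
  under eq_fun do rewrite big_nil; rewrite cpartial_cst.
  by apply/funext => x; rewrite big_nil.
rewrite (_ : (fun x => _) = fun x => F j x + \sum_(j <- s) F j x); last first.
  by apply/funext => x; rewrite big_cons.
rewrite cpartialD//; last exact: csmooth_sum.
by rewrite IH; apply/funext => x; rewrite big_cons.
Qed.

(** A quadratic remainder valid for all [h] can be summed over a series, which a mere limit of
    quotients cannot; this is the form used for termwise differentiation. *)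
Lemma derivable_quad f (v x : 'rV[R]_N) (d K : R) :
  (forall h : R, `|f (h *: v + x) - f x - h * d| <= K * h ^+ 2) ->
  derivable f x v /\ 'D_v f x = d.
Proof.
move=> H.
have K0 : 0 <= K by have := H 1; rewrite expr1n mulr1; exact: le_trans.
suff L : (fun h : R => h^-1 *: (f (h *: v + x) - f x)) @ 0^' --> d.
  by split; [apply/cvg_ex; exists d|exact: cvg_lim L].
apply/cvgrPdist_le => e e0.
have K1 : 0 < K + 1 by rewrite ltr_wpDl.
apply/nbhs_ballP; exists (e / (K + 1)); first by rewrite /= divr_gt0.
move=> h /=; rewrite /ball/= sub0r normrN ltr_pdivlMr// => he h0.
have -> : d - h^-1 *: (f (h *: v + x) - f x) =
   - h^-1 * (f (h *: v + x) - f x - h * d).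
  by rewrite mulNr mulrBr mulKf// opprB.
rewrite normrM normrN normfV ler_pdivrMl ?normr_gt0//; apply: le_trans (H h) _.
rewrite -real_normK ?num_real// mulrC expr2 -mulrA ler_wpM2l//.
by apply: le_trans (ltW he); rewrite ler_wpM2l// lerDl.
Qed.

Lemma cpartial_quad F i (x : 'rV[R]_N) (d : R[i]) (K : R) :
  (forall h : R, normc (F (h *: delta_mx 0 i + x) - F x - h%:C * d) <= K * h ^+ 2) ->
  [/\ derivable (re F) x (delta_mx 0 i), derivable (im F) x (delta_mx 0 i)
    & cpartial i F x = d].
Proof.
move=> H.
have [d1 D1] : derivable (re F) x (delta_mx 0 i) /\
    'D_(delta_mx 0 i) (re F) x = complex.Re d.
  apply: (@derivable_quad _ _ _ _ K) => h; apply: le_trans (H h).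
  apply: le_trans (Re_le_normc _).
  by rewrite !cReD !cReN cReM /= mul0r subr0.
have [d2 D2] : derivable (im F) x (delta_mx 0 i) /\
    'D_(delta_mx 0 i) (im F) x = complex.Im d.
  apply: (@derivable_quad _ _ _ _ K) => h; apply: le_trans (H h).
  apply: le_trans (Im_le_normc _).
  by rewrite !cImD !cImN cImM /= mul0r addr0.
by split => //; exact: complexP.
Qed.

End SmoothAlgebra.


(** * First- and second-order bounds on increments of characters *)

Section CharacterDerivatives.
Context {R : realType}.

Lemma expi_quad (h : R) : normc (expi h - 1 - (0 +i* h)) <= 2 * h ^+ 2.
Proof.
have sinle (t : R) : `|sin t| <= `|t|.
  have [c _] := MVT_between t (fun x => is_derive_sin x).
  by rewrite sin0 subr0 => ->; rewrite normrM ler_piMl// cos_max.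
have [c ch E] := MVT_between h (fun x => is_derive_cos x).
have Ec : `|cos h - 1| <= h ^+ 2.
  rewrite -cos0 E normrM normrN -real_normK ?num_real// expr2.
  by rewrite ler_wpM2r//; exact: le_trans (sinle c) ch.
have c1 (t : R) : `|cos t - 1| <= `|t|.
  have [s _] := MVT_between t (fun x => is_derive_cos x).
  rewrite cos0 => ->; rewrite normrM normrN ler_piMl// ler_norml.
  by rewrite sin_geN1 sin_le1.
have [s sh Es] := MVT_between h (fun x => is_derive_sin x).
have Sh : `|sin h - h| <= h ^+ 2.
  have -> : sin h - h = (cos s - 1) * h.
    by move: Es; rewrite sin0 subr0 => ->; rewrite mulrBl mul1r.
  rewrite normrM -real_normK ?num_real// expr2.
  by rewrite ler_wpM2r//; exact: le_trans (c1 s) sh.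
apply: le_trans (normc_le_ReIm _) _.
rewrite !cReD !cImD !cReN !cImN /= !subr0.
by rewrite [2 * _]mulr_natl mulr2n lerD.
Qed.

Lemma expi_lip (h : R) : normc (expi h - 1) <= 2 * `|h|.
Proof.
have [c _] := MVT_between h (fun x => is_derive_cos x).
have [s _] := MVT_between h (fun x => is_derive_sin x).
rewrite sin0 cos0 => Es Ec.
apply: le_trans (normc_le_ReIm _) _.
rewrite cReD cImD cReN cImN /= Es Ec.
rewrite [2 * _]mulr_natl mulr2n; apply: lerD; rewrite normrM ler_piMl//.
  by rewrite normrN ler_norml sin_geN1 sin_le1.
exact: cos_max.
Qed.

Definition ik N (k : 'rV[int]_N) i : R[i] := 0 +i* (k 0 i)%:~R.

Lemma normc_ik N (k : 'rV[int]_N) i : normc (ik k i) = `|(k 0 i)%:~R|.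
Proof. exact: normc_i. Qed.

Lemma normc_ik_le N (k : 'rV[int]_N) i : normc (ik k i) <= 1 + knorm k.
Proof. by rewrite normc_ik (le_trans (coord_le_knorm k i))// lerDr. Qed.

Lemma chr_quad N (k : 'rV[int]_N) i (h : R) x :
  normc (chr k (h *: delta_mx 0 i + x) - chr k x - h%:C * (ik k i * chr k x))
  <= 2 * (1 + knorm k) ^+ 2 * h ^+ 2.
Proof.
rewrite chr_shift chr_delta.
set a : R := (k 0 i)%:~R.
have -> : expi (a * h) * chr k x - chr k x - h%:C * (ik k i * chr k x) =
  (expi (a * h) - 1 - (0 +i* (a * h))) * chr k x.
  have -> : (0 +i* (a * h)) = h%:C * ik k i.
    by apply: complexP; rewrite /= /a; ring.
  by ring.
rewrite normcM normc_chr mulr1; apply: le_trans (expi_quad _) _.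
rewrite -mulrA ler_wpM2l// exprMn ler_wpM2r ?sqr_ge0//.
rewrite -real_normK ?num_real// ler_pXn2r ?nnegrE ?addr_ge0 ?knorm_ge0//.
by rewrite (le_trans (coord_le_knorm k i))// lerDr.
Qed.

Lemma coord_le_norm N (x : 'rV[R]_N) i : `|x 0 i| <= `|x|.
Proof.
rewrite [leRHS]/Num.norm/= mx_normrE.
exact: (le_bigmax _ (fun ij : 'I_1 * 'I_N => `|x ij.1 ij.2|) (0, i)).
Qed.

Lemma chr_lip N (k : 'rV[int]_N) (x y : 'rV[R]_N) :
  normc (chr k y - chr k x) <= 2 * (1 + knorm k) * `|y - x|.
Proof.
have -> : chr k y - chr k x = (chr k (y - x) - 1) * chr k x.
  by rewrite mulrBl mul1r -chr_shift subrK.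
rewrite normcM normc_chr mulr1; apply: le_trans (expi_lip _) _.
rewrite -mulrA ler_wpM2l//; apply: le_trans (ler_norm_sum _ _ _) _.
apply: (@le_trans _ _ (knorm k * `|y - x|)); last first.
  by rewrite ler_wpM2r// lerDr.
rewrite /knorm mulr_suml; apply: ler_sum => i _.
rewrite normrM ler_wpM2l//.
by have := coord_le_norm (y - x) i; rewrite !mxE.
Qed.

Lemma cpartial_chr N (k : 'rV[int]_N) i :
  cpartial i (chr k) = fun x : 'rV[R]_N => ik k i * chr k x.
Proof.
by apply/funext => x; have [] := cpartial_quad (fun h => chr_quad k i h x).
Qed.

Lemma chr_csmooth N (k : 'rV[int]_N) : csmooth (@chr R N k).
Proof.
apply: (@csmooth_coind _ _ (fun F => exists c, F = fun x => c * chr k x)); last first.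
  by exists 1; apply/funext => x; rewrite mul1r.
move=> _ [c ->].
have H i x : [/\ derivable (re (fun x => c * chr k x)) x (delta_mx 0 i),
   derivable (im (fun x => c * chr k x)) x (delta_mx 0 i)
    & cpartial i (fun x => c * chr k x) x = c * (ik k i * chr k x)].
  apply: (@cpartial_quad _ _ _ _ _ _ (normc c * (2 * (1 + knorm k) ^+ 2))) => h.
  rewrite mulrCA -!mulrBr normcM -mulrA ler_wpM2l ?normc_ge0//; exact: chr_quad.
split.
- by apply: ccontinuousM; [exact: ccontinuous_cst|exact: chr_ccontinuous].
- by move=> i x; case: (H i x).
- move=> i; exists (c * ik k i); apply/funext => x.
  by case: (H i x) => _ _ ->; rewrite mulrA.
Qed.

End CharacterDerivatives.

(** * Reduction to a fundamental domain and uniqueness at all points *)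

Section TorusPeriodicity.
Context {R : realType} {N : nat}.
Implicit Types F G : 'rV[R]_N -> R[i].

Lemma torus_periodicM F G :
  torus_periodic F -> torus_periodic G -> torus_periodic (fun x => F x * G x).
Proof. by move=> pF pG i x; rewrite pF pG. Qed.

Lemma torus_periodicD F G :
  torus_periodic F -> torus_periodic G -> torus_periodic (fun x => F x + G x).
Proof. by move=> pF pG i x; rewrite pF pG. Qed.

Lemma partial_periodic (f : 'rV[R]_N -> R) i :
  torus_periodic f -> torus_periodic (partial i f).
Proof.
move=> pf j x; rewrite /partial /derive.
rewrite (_ : (fun h : R => h^-1 *: (f (h *: delta_mx 0 i + (x + (2 * pi) *: delta_mx 0 j)) -
    f (x + (2 * pi) *: delta_mx 0 j)))
   = (fun h : R => h^-1 *: (f (h *: delta_mx 0 i + x) - f x))) //.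
by apply/funext => h; rewrite addrA !pf.
Qed.

Lemma re_periodic F : torus_periodic F -> torus_periodic (re F).
Proof. by move=> pF i x; rewrite /re pF. Qed.

Lemma im_periodic F : torus_periodic F -> torus_periodic (im F).
Proof. by move=> pF i x; rewrite /im pF. Qed.

Lemma cpartial_periodic F i : torus_periodic F -> torus_periodic (cpartial i F).
Proof.
move=> pF j x; rewrite /cpartial.
by rewrite (partial_periodic i (re_periodic pF)) (partial_periodic i (im_periodic pF)).
Qed.

Lemma smooth_torusP F : smooth_torus F <-> csmooth F /\ torus_periodic F.
Proof. by split=> [[? ? ?]|[[? ?] ?]]; split. Qed.

Lemma smooth_torusM F G : smooth_torus F -> smooth_torus G -> smooth_torus (fun x => F x * G x).
Proof.
move=> /smooth_torusP[sF pF] /smooth_torusP[sG pG]; apply/smooth_torusP.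
by split; [exact: csmoothM|exact: torus_periodicM].
Qed.

Lemma smooth_torusD F G : smooth_torus F -> smooth_torus G -> smooth_torus (fun x => F x + G x).
Proof.
move=> /smooth_torusP[sF pF] /smooth_torusP[sG pG]; apply/smooth_torusP.
by split; [exact: csmoothD|exact: torus_periodicD].
Qed.

Lemma smooth_torus_cst c : smooth_torus (fun _ : 'rV[R]_N => c).
Proof. by apply/smooth_torusP; split; first exact: csmooth_cst. Qed.

Lemma smooth_torus_chr k : smooth_torus (@chr R N k).
Proof. by apply/smooth_torusP; split; [exact: chr_csmooth|exact: chr_periodic]. Qed.

Lemma smooth_torus_cpartial F i : smooth_torus F -> smooth_torus (cpartial i F).
Proof.
move=> /smooth_torusP[sF pF]; apply/smooth_torusP.
by split; [exact: csmooth_cpartial|exact: cpartial_periodic].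
Qed.

Lemma smooth_torus_cpartials F l : smooth_torus F -> smooth_torus (cpartials l F).
Proof. by move=> sF; elim: l => [//|i l IH]; exact: smooth_torus_cpartial. Qed.

Lemma smooth_torus_continuous F : smooth_torus F -> ccontinuous F.
Proof. by move=> /smooth_torusP[sF _]; exact: csmooth_continuous. Qed.

Lemma torus_cint_cpartial F i : smooth_torus F -> torus_cint (cpartial i F) = 0.
Proof.
move=> [sr si pF]; apply: complexP => /=.
  apply: torus_int_partial.
  - exact: smooth_continuous.
  - by move=> x; exact: smooth_derivable.
  - by apply: smooth_continuous; exact: smooth_partial.
  - exact: re_periodic.
apply: torus_int_partial.
- exact: smooth_continuous.
- by move=> x; exact: smooth_derivable.
- by apply: smooth_continuous; exact: smooth_partial.
- exact: im_periodic.
Qed.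

Lemma periodic_int (T : zmodType) (F : 'rV[R]_N -> T) i (m : int) x :
  torus_periodic F -> F (x + (m%:~R * (2 * pi)) *: delta_mx 0 i) = F x.
Proof.
move=> pF.
have H n y : F (y + (n%:R * (2 * pi)) *: delta_mx 0 i) = F y.
  elim: n y => [|n IH] y; first by rewrite mul0r scale0r addr0.
  by rewrite -natr1 mulrDl mul1r scalerDl addrA pF.
case: m => n; first by rewrite -pmulrn.
rewrite NegzE mulrNz -pmulrn mulNr scaleNr.
by rewrite -[LHS](H n.+1) subrK.
Qed.

Lemma periodic_reduce (T : zmodType) (F : 'rV[R]_N -> T) (x : 'rV[R]_N) :
  torus_periodic F ->
  exists y : 'rV[R]_N, F y = F x /\ forall i, 0 <= y 0 i < 2 * pi.
Proof.
move=> pF.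
have t0 := @twopi_gt0 R.
pose m i := Num.floor (x 0 i / (2 * pi)).
exists (x + \sum_i ((- m i)%:~R * (2 * pi)) *: delta_mx 0 i); split.
  elim: (index_enum _) => [|i s IH]; first by rewrite big_nil addr0.
  by rewrite big_cons addrCA addrC periodic_int.
move=> i; rewrite mxE summxE (bigD1 i)//= big1 ?addr0; last first.
  by move=> j ji; rewrite !mxE eq_sym (negbTE ji) mulr0.
rewrite !mxE !eqxx mulr1 mulrNz mulNr subr_ge0 -ler_pdivlMr// ltrBlDl.
by rewrite floor_le/= -{2}[2 * pi]mul1r -mulrDl -ltr_pdivrMr// -[1]/(1%:~R) -intrD floorD1_gt.
Qed.

(** The representative [y] in [[0, 2 pi)^N] may have zero coordinates. The points
    [y + t (1, ..., 1)] with small [t > 0] lie in the open box, where [F] vanishes; continuity gives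
    the value at [y]. *)
Lemma torus_cint_uniq F : ccontinuous F -> torus_periodic F ->
  (forall k, torus_cint (fun x => F x * chr k x) = 0) -> forall x, F x = 0.
Proof.
move=> cF pF F0 x.
have [y [<- hy]] := periodic_reduce x pF.
pose v : 'rV[R]_N := const_mx 1.
have cv : continuous (fun t : R => y + t *: v).
  by move=> t; apply: cvgD; [exact: cvg_cst|apply: cvgZr_tmp; exact: cvg_id].
have Fv : \forall t \near (0 : R)^'+, F (y + t *: v) = 0.
  have small i : \forall t \near (0 : R)^'+, t < 2 * pi - y 0 i.
    by apply: nbhs_right_lt; rewrite subr_gt0; case/andP: (hy i).
  have all_small : \forall t \near (0 : R)^'+, forall i, t < 2 * pi - y 0 i.
    by apply: filter_forall => i; exact: small.
  near=> t; apply: torus_cint_uniq_box => // i.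
  have t0 : 0 < t by near: t; exact: nbhs_right_gt.
  rewrite !mxE mulr1; case/andP: (hy i) => y0 _.
  rewrite ltr_wpDl//=; have : t < 2 * pi - y 0 i by move: (i); near: t.
  by rewrite ltrBrDl.
case: cF => c1 c2.
have lim0 (g : 'rV[R]_N -> R) : continuous g ->
    (\forall t \near (0 : R)^'+, g (y + t *: v) = 0) -> g y = 0.
  move=> cg gv.
  have L : (fun t : R => g (y + t *: v)) @ 0^'+ --> g y.
    have E : g y = g (y + 0 *: v) by rewrite scale0r addr0.
    by rewrite [X in _ --> X]E; apply: cvg_at_right_filter; exact: (continuous_compose cv cg).
  have L0 : (fun t : R => g (y + t *: v)) @ 0^'+ --> (0 : R).
    by apply: cvg_near_cst.
  exact: cvg_unique L L0.
apply: complexP => /=; [apply: (lim0 _ c1)|apply: (lim0 _ c2)];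
  by near=> t; have -> // : F (y + t *: v) = 0 by near: t.
Unshelve. all: by end_near.
Qed.

End TorusPeriodicity.

(** * Fourier series and distributions *)

Section FourierSeries.
Context {R : realType} {N : nat}.
Implicit Types (phi psi F : 'rV[R]_N -> R[i]) (c : 'rV[int]_N -> R[i]) (k : 'rV[int]_N).

Definition fc phi k : R[i] :=
  ((2 * pi) ^- N)%:C * torus_cint (fun x => phi x * chr (- k) x).

Definition ikl k (l : seq 'I_N) : R[i] := \prod_(i <- l) ik k i.

Definition rapid c : Prop :=
  forall m, exists A : R, forall k, normc (c k) * (1 + knorm k) ^+ m <= A.

Definition fseries c : 'rV[R]_N -> R[i] := fun x => lsum (fun k => c k * chr k x).

Let t_gt0 : 0 < (2 * pi : R) ^+ N.
Proof. by rewrite exprn_gt0// twopi_gt0. Qed.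

Lemma twopiXK : ((2 * pi : R) ^- N)%:C * ((2 * pi) ^+ N)%:C = 1.
Proof. by rewrite -rmorphM mulVf ?gt_eqF. Qed.

Lemma torus_cint_chr phi k :
  torus_cint (fun x => phi x * chr k x) = ((2 * pi) ^+ N)%:C * fc phi (- k).
Proof. by rewrite /fc opprK mulrA [_%:C * _%:C]mulrC twopiXK mul1r. Qed.

Lemma normc_ikl k l : normc (ikl k l) <= (1 + knorm k) ^+ size l.
Proof.
rewrite /ikl; elim: l => [|i l IH]; first by rewrite big_nil normc1 expr0.
rewrite big_cons normcM exprS ler_pM ?normc_ge0//; exact: normc_ik_le.
Qed.

Lemma ik_opp k i : ik (- k) i = - ik k i :> R[i].
Proof. by apply: complexP; rewrite /= ?oppr0// mxE mulrNz. Qed.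

(** Integration by parts: the partial of [phi * chr (- k)] has integral zero. *)
Lemma fc_cpartial phi i k : smooth_torus phi ->
  fc (cpartial i phi) k = ik k i * fc phi k.
Proof.
move=> sp; have cp := smooth_torus_continuous sp.
have sE := @smooth_torus_chr R N (- k).
have := torus_cint_cpartial i (smooth_torusM sp sE).
case/smooth_torusP: (sp) => csp _; case/smooth_torusP: (sE) => csE _.
rewrite cpartialM// cpartial_chr.
have -> : (fun x => cpartial i phi x * chr (- k) x + phi x * (ik (- k) i * chr (- k) x)) =
  (fun x => cpartial i phi x * chr (- k) x + - ik k i * (phi x * chr (- k) x)).
  by apply/funext => x; rewrite ik_opp mulrCA.
have c1 : ccontinuous (fun x => phi x * chr (- k) x).
  by apply: ccontinuousM => //; exact: chr_ccontinuous.
rewrite torus_cintD ?torus_cintZ//; last 2 first.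
- apply: ccontinuousM; last exact: chr_ccontinuous.
  by apply: smooth_torus_continuous; exact: smooth_torus_cpartial.
- by apply: ccontinuousM => //; exact: ccontinuous_cst.
by move/eqP; rewrite mulNr subr_eq0 => /eqP E; rewrite /fc E mulrCA.
Qed.

Lemma fc_cpartials phi l k : smooth_torus phi ->
  fc (cpartials l phi) k = ikl k l * fc phi k.
Proof.
move=> sp; elim: l => [|i l IH]; first by rewrite /ikl big_nil mul1r.
by rewrite /= fc_cpartial ?IH ?/ikl ?big_cons ?mulrA//; exact: smooth_torus_cpartials.
Qed.

Lemma normc_fc phi M k : ccontinuous phi -> (forall x, normc (phi x) <= M) ->
  normc (fc phi k) <= 2 * M.
Proof.
move=> cp pM; rewrite normcM normc_real gtr0_norm ?invr_gt0// ler_pdivrMl// mulrC.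
apply: normc_torus_cint; first by apply: ccontinuousM => //; exact: chr_ccontinuous.
by move=> x; rewrite normcM normc_chr mulr1.
Qed.

Lemma torus_bounded phi : ccontinuous phi -> torus_periodic phi ->
  exists M, forall x, normc (phi x) <= M.
Proof.
move=> [c1 c2] pp.
have [M1 H1] := compact_bound c1 (@box_compact R N).
have [M2 H2] := compact_bound c2 (@box_compact R N).
exists (M1 + M2) => x; have [y [<- hy]] := periodic_reduce x pp.
have By : box y by move=> i; case/andP: (hy i) => y0 y1; rewrite /= in_itv/= y0 ltW.
by apply: le_trans (normc_le_ReIm _) _; rewrite lerD ?H1 ?H2.
Qed.

(** One derivative per power of the weight: [|k_i|] times the coefficient of [phi] is the modulus of
    that of its [i]-th partial. Hence [phi] varies in the induction. *)
Lemma fc_rapid phi : smooth_torus phi -> rapid (fc phi).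
Proof.
move=> sp m; elim: m phi sp => [|m IH] phi sp.
  have [|M HM] := torus_bounded (smooth_torus_continuous sp).
    by case/smooth_torusP: sp.
  exists (2 * M) => k; rewrite expr0 mulr1; apply: normc_fc HM.
  exact: smooth_torus_continuous.
have [A0 H0] := IH phi sp.
have H i : exists A, forall k, normc (fc (cpartial i phi) k) * (1 + knorm k) ^+ m <= A.
  by apply: IH; exact: smooth_torus_cpartial.
have [A HA] := choice H.
exists (A0 + \sum_i A i) => k.
rewrite exprS mulrCA mulrDl mul1r [knorm k * _]mulrC; apply: lerD => //.
rewrite /knorm mulr_sumr; apply: ler_sum => i _; apply: le_trans (HA i k).
rewrite fc_cpartial// [normc (ik _ _ * _)]normcM normc_ik.
by rewrite le_eqVlt; apply/orP; left; apply/eqP; ring.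
Qed.

Lemma rapid_wt c m : rapid c ->
  exists A : R, forall k, normc (c k) * (1 + knorm k) ^+ m <= A * wt k.
Proof.
move=> rc; have [A HA] := rc (m + N.*2)%N; exists A => k.
by rewrite /wt ler_pdivlMr ?exprn_gt0 ?knormP1_gt0// -mulrA -exprD.
Qed.

Lemma rapidM c (d : 'rV[int]_N -> R[i]) (B : R) p : rapid c ->
  (forall k, normc (d k) <= B * (1 + knorm k) ^+ p) -> rapid (fun k => d k * c k).
Proof.
move=> rc dB m; have [A HA] := rc (m + p)%N.
have B0 : 0 <= B.
  by have := dB 0; rewrite -ler_pdivrMr ?exprn_gt0 ?knormP1_gt0//;
    apply: le_trans; rewrite divr_ge0 ?normc_ge0 ?exprn_ge0 ?ltW ?knormP1_gt0.
exists (B * A) => k; rewrite normcM -mulrA.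
apply: (@le_trans _ _ (B * (1 + knorm k) ^+ p * (normc (c k) * (1 + knorm k) ^+ m))).
  by rewrite ler_wpM2r ?dB// mulr_ge0 ?normc_ge0// exprn_ge0// ltW// knormP1_gt0.
rewrite -mulrA ler_wpM2l//; apply: le_trans (HA k).
by rewrite mulrCA -exprD addnC.
Qed.

Lemma rapid_dom c : rapid c -> exists A : R, forall k, normc (c k) <= A * wt k.
Proof.
by move=> /(rapid_wt 0)[A HA]; exists A => k; have := HA k; rewrite expr0 mulr1.
Qed.

Lemma dom_chr c A x : (forall k, normc (c k) <= A * wt k) ->
  forall k, normc (c k * chr k x) <= A * wt k.
Proof. by move=> cA k; rewrite normcM normc_chr mulr1. Qed.

Lemma lip_continuous (f : 'rV[R]_N -> R) (K : R) :
  (forall x y, `|f y - f x| <= K * `|y - x|) -> continuous f.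
Proof.
move=> H x; apply/(@cvgrPdist_le _ _ _ (nbhs x)) => e e0.
have K1 : 0 < `|K| + 1 by rewrite ltr_wpDl.
apply/nbhs_ballP; exists (e / (`|K| + 1)); first by rewrite /= divr_gt0.
move=> y; rewrite -ball_normE /= => xy; rewrite distrC; apply: le_trans (H x y) _.
rewrite distrC; apply: (@le_trans _ _ ((`|K| + 1) * `|x - y|)).
  by rewrite ler_wpM2r// (le_trans (ler_norm K))// lerDl.
by rewrite mulrC -ler_pdivlMr// ltW.
Qed.

Lemma fseries_diff c x y : rapid c -> fseries c y - fseries c x =
  lsum (fun k => c k * (chr k y - chr k x)).
Proof.
move=> /rapid_dom[A cA].
have cN k : normc (-1 * (c k * chr k x)) <= A * wt k.
  by rewrite normcM normc_opp normc1 mul1r; exact: dom_chr.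
rewrite /fseries -mulN1r -(lsumZ _ (dom_chr x cA)) -(lsumD (dom_chr y cA) cN).
by congr lsum; apply/funext => k; rewrite mulN1r mulrBr.
Qed.

Lemma fseries_ccontinuous c : rapid c -> ccontinuous (fseries c).
Proof.
move=> rc; have [A HA] := rapid_wt 1 rc.
have L x y : normc (fseries c y - fseries c x) <= (4 * A * tail N 0) * `|y - x|.
  rewrite fseries_diff//.
  apply: le_trans (normc_lsum (A := 2 * A * `|y - x|) _) _; last first.
    by rewrite le_eqVlt; apply/orP; left; apply/eqP; ring.
  move=> k; rewrite normcM.
  apply: (@le_trans _ _ (normc (c k) * (2 * (1 + knorm k) * `|y - x|))).
    by rewrite ler_wpM2l ?normc_ge0//; exact: chr_lip.
  have := HA k; rewrite expr1 => H.
  have -> : normc (c k) * (2 * (1 + knorm k) * `|y - x|) =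
    (normc (c k) * (1 + knorm k)) * (2 * `|y - x|) by ring.
  have -> : 2 * A * `|y - x| * wt k = (A * wt k) * (2 * `|y - x|) by ring.
  by rewrite ler_wpM2r// mulr_ge0.
split; apply: (@lip_continuous _ (4 * A * tail N 0)) => x y.
  by apply: le_trans (L x y); apply: le_trans (Re_le_normc _); rewrite cReD cReN.
by apply: le_trans (L x y); apply: le_trans (Im_le_normc _); rewrite cImD cImN.
Qed.

Lemma rapid_ik c i : rapid c -> rapid (fun k => ik k i * c k).
Proof. by move=> rc; apply: (@rapidM _ _ 1 1 rc) => k; rewrite mul1r expr1 normc_ik_le. Qed.

(** Termwise differentiation: the second-order remainder of [chr k] is at most [2 (1 + |k|)^2 h^2],
    which remains summable against rapidly decreasing coefficients. *)
Lemma fseries_derivable c i x : rapid c ->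
  [/\ derivable (re (fseries c)) x (delta_mx 0 i),
      derivable (im (fseries c)) x (delta_mx 0 i)
    & cpartial i (fseries c) x = fseries (fun k => ik k i * c k) x].
Proof.
move=> rc; have [A HA] := rapid_wt 2 rc.
have [B HB] := rapid_dom (rapid_ik i rc).
have [D HD] := rapid_dom rc.
apply: (@cpartial_quad _ _ _ _ _ _ (4 * A * tail N 0)) => h.
set y := h *: delta_mx 0 i + x.
have B1 k : normc (- h%:C * (ik k i * c k * chr k x)) <= (`|h| * B) * wt k.
  rewrite normcM normc_opp normc_real -[leRHS]mulrA ler_wpM2l//; exact: (dom_chr x HB).
have D1 k : normc (c k * (chr k y - chr k x)) <= (D + D) * wt k.
  rewrite mulrBr mulrDl; apply: le_trans (normcD _ _) _; rewrite normc_opp.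
  by apply: lerD; exact: (dom_chr _ HD).
rewrite fseries_diff// -mulNr /fseries -(lsumZ _ (dom_chr x HB)) -(lsumD D1 B1).
apply: le_trans (normc_lsum (A := 2 * A * h ^+ 2) _) _; last first.
  by rewrite le_eqVlt; apply/orP; left; apply/eqP; ring.
move=> k.
have -> : c k * (chr k y - chr k x) + - h%:C * (ik k i * c k * chr k x) =
  c k * (chr k y - chr k x - h%:C * (ik k i * chr k x)) by ring.
rewrite normcM.
apply: (@le_trans _ _ (normc (c k) * (2 * (1 + knorm k) ^+ 2 * h ^+ 2))).
  by rewrite ler_wpM2l ?normc_ge0//; exact: chr_quad.
have -> : normc (c k) * (2 * (1 + knorm k) ^+ 2 * h ^+ 2) =
  (normc (c k) * (1 + knorm k) ^+ 2) * (2 * h ^+ 2) by ring.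
have -> : 2 * A * h ^+ 2 * wt k = (A * wt k) * (2 * h ^+ 2) by ring.
by rewrite ler_wpM2r// mulr_ge0// sqr_ge0.
Qed.

Lemma fseries_smooth c : rapid c -> smooth_torus (fseries c).
Proof.
move=> rc; apply/smooth_torusP; split; last first.
  move=> i x; rewrite /fseries; congr lsum; apply/funext => k.
  by rewrite chr_periodic.
apply: (@csmooth_coind _ _ (fun F => exists2 d, rapid d & F = fseries d)); last by exists c.
move=> _ [d rd ->]; split.
- exact: fseries_ccontinuous.
- by move=> i x; case: (fseries_derivable i x rd).
- move=> i; exists (fun k => ik k i * d k); first exact: rapid_ik.
  by apply/funext => x; case: (fseries_derivable i x rd).
Qed.

Definition fpart c J : 'rV[R]_N -> R[i] := fun x => psum (fun k => c k * chr k x) J.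

Lemma csmooth_chrZ (z : R[i]) k : csmooth (fun x : 'rV[R]_N => z * chr k x).
Proof. by apply: csmoothM; [exact: csmooth_cst|exact: chr_csmooth]. Qed.

Lemma fpart_smooth c J : smooth_torus (fpart c J).
Proof.
apply/smooth_torusP; split.
  by apply: csmooth_sum => k; exact: csmooth_chrZ.
by move=> i x; apply: eq_bigr => k _; rewrite chr_periodic.
Qed.

Lemma torus_cint_fseries c phi : rapid c -> smooth_torus phi ->
  torus_cint (fun x => fseries c x * phi x) =
  lsum (fun k => c k * torus_cint (fun x => chr k x * phi x)).
Proof.
move=> rc sp; have cp := smooth_torus_continuous sp.
have [|M HM] := torus_bounded cp; first by case/smooth_torusP: sp.
have [A HA] := rapid_dom rc.
have cE k : ccontinuous (fun x => chr k x * phi x).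
  by apply: ccontinuousM => //; exact: chr_ccontinuous.
apply: (@lsum_eq _ _ _ (A * (2 * M * (2 * pi) ^+ N)) _ (2 * (2 * A * M) * (2 * pi) ^+ N)).
  move=> k; rewrite normcM mulrAC ler_pM ?normc_ge0//.
  by apply: normc_torus_cint => // x; rewrite normcM normc_chr mul1r.
move=> J.
have -> : psum (fun k => c k * torus_cint (fun x => chr k x * phi x)) J =
    torus_cint (fun x => fpart c J x * phi x).
  rewrite /psum; under eq_bigr do rewrite -torus_cintZ//.
  rewrite -torus_cint_sum; last first.
    by move=> k; apply: ccontinuousM => //; exact: ccontinuous_cst.
  by congr torus_cint; apply/funext => x; rewrite /fpart /psum mulr_suml;
    apply: eq_bigr => k _; rewrite mulrA.
have cF := fseries_ccontinuous rc.
have cS := smooth_torus_continuous (fpart_smooth c J).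
rewrite -mulN1r -torus_cintZ; last exact: ccontinuousM.
have cSp : ccontinuous (fun x => -1 * (fpart c J x * phi x)).
  by apply: ccontinuousM; [exact: ccontinuous_cst|exact: ccontinuousM].
rewrite -torus_cintD//; last exact: ccontinuousM.
apply: le_trans (normc_torus_cint (M := 2 * A * tail N J * M) _ _) _.
- by apply: ccontinuousD => //; exact: ccontinuousM.
- move=> x; rewrite mulN1r -mulNr -mulrDl normcM ler_pM ?normc_ge0//.
  by apply: lsum_tail; exact: (dom_chr _ HA).
by rewrite le_eqVlt; apply/orP; left; apply/eqP; ring.
Qed.

(** For [k_i] nonzero, [i k_i] times the integral is the integral of a partial derivative, hence
    zero. *)
Lemma torus_cint_chr0 k : torus_cint (@chr R N k) = if k == 0 then ((2 * pi : R) ^+ N)%:C else 0.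
Proof.
have [->|k0] := eqVneq.
  apply: complexP => /=; rewrite ?/re ?/im.
    rewrite (_ : (fun x => _) = fun=> 1); last by apply/funext => x; rewrite chr0.
    by rewrite torus_int_cst mul1r.
  rewrite (_ : (fun x => _) = fun=> 0); last by apply/funext => x; rewrite chr0.
  by rewrite torus_int_cst mul0r.
have [i ki] : exists i, k 0 i != 0.
  apply/existsP; apply: contraNT k0; rewrite negb_exists => /forallP H.
  by apply/eqP/rowP => i; have := H i; rewrite negbK mxE => /eqP.
have := torus_cint_cpartial i (@smooth_torus_chr R N k).
rewrite cpartial_chr torus_cintZ; last exact: chr_ccontinuous.
move/eqP; rewrite mulf_eq0 => /orP[|/eqP//].
by rewrite /ik eq_complex /= eqxx /= intr_eq0 (negbTE ki).
Qed.

Lemma lsum_delta k (z : R[i]) : lsum (fun l => if l == k then z else 0) = z.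
Proof.
have H l : normc (if l == k then z else 0) <= normc z / wt k * wt l.
  have [->|_] := eqVneq; first by rewrite divfK// gt_eqF// wt_gt0.
  by rewrite normc0 mulr_ge0 ?divr_ge0 ?normc_ge0 ?(ltW (wt_gt0 _)).
apply/eqP; rewrite -subr_eq0; apply/eqP/normc_eq0P.
apply/ler_addgt0Pr => e e0; rewrite add0r.
have [J0 HJ] := tail_small N (2 * (normc z / wt k)) e0.
(* Beyond the code of [k] the partial sum is exactly [z], so the error is pure truncation error. *)
apply: le_trans (HJ (maxn J0 (pickle k).+1) (leq_maxl _ _)).
rewrite (_ : lsum _ - z = lsum (fun l => if l == k then z else 0) -
  psum (fun l => if l == k then z else 0) (maxn J0 (pickle k).+1)); last first.
  congr (_ - _); rewrite /psum -big_mkcond/= -big_filter.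
  rewrite (_ : [seq _ <- _ | _] = [:: k]) ?big_seq1//.
  have u := filter_uniq (pred1 k) (@lattice_enum_uniq N (maxn J0 (pickle k).+1)).
  apply: perm_small_eq => //; apply: uniq_perm => // l.
  rewrite mem_filter inE; case: eqP => //= ->.
  by rewrite mem_lattice_enum leq_max leqnn orbT.
exact: lsum_tail.
Qed.

Lemma fc_fseries c k : rapid c -> fc (fseries c) k = c k.
Proof.
move=> rc; rewrite /fc torus_cint_fseries//; last exact: smooth_torus_chr.
rewrite (_ : (fun l => _) = fun l => if l == k then c k * ((2 * pi) ^+ N)%:C else 0).
  by rewrite lsum_delta mulrCA twopiXK mulr1.
apply/funext => l.
rewrite (_ : (fun x => _) = chr (l - k)); last by apply/funext => x; rewrite chrD.
by rewrite torus_cint_chr0 subr_eq0; case: eqP => [->//|_]; rewrite mulr0.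
Qed.

(** The difference of the two sides is continuous and periodic with all coefficients zero. *)
Lemma fourier_inversion phi : smooth_torus phi -> fseries (fc phi) = phi.
Proof.
move=> sp; have rc := fc_rapid sp; have sF := fseries_smooth rc.
have cp := smooth_torus_continuous sp; have cF := smooth_torus_continuous sF.
pose D x := phi x + -1 * fseries (fc phi) x.
have cN : ccontinuous (fun x => -1 * fseries (fc phi) x).
  by apply: ccontinuousM => //; exact: ccontinuous_cst.
have D0 : forall x, D x = 0.
  apply: torus_cint_uniq.
  - exact: ccontinuousD.
  - apply: torus_periodicD; first by case/smooth_torusP: sp.
    by apply: torus_periodicM => //; case/smooth_torusP: sF.
  move=> k.
  have ce := @chr_ccontinuous R N k.
  rewrite (_ : (fun x => _) = fun x => phi x * chr k x + -1 * (fseries (fc phi) x * chr k x)).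
    rewrite torus_cintD ?torus_cintZ ?torus_cint_chr ?fc_fseries ?mulN1r ?subrr//.
    - exact: ccontinuousM.
    - exact: ccontinuousM.
    - by apply: ccontinuousM; [exact: ccontinuous_cst|exact: ccontinuousM].
  by apply/funext => x; rewrite /D mulrDl mulrA.
by apply/funext => x; apply/eqP; rewrite eq_sym -subr_eq0 -mulN1r; apply/eqP; exact: D0.
Qed.

Lemma fc_inj phi psi : smooth_torus phi -> smooth_torus psi -> fc phi = fc psi -> phi = psi.
Proof. by move=> sp sq E; rewrite -(fourier_inversion sp) E fourier_inversion. Qed.

Lemma cpartials_fpart c J l : cpartials l (fpart c J) = fpart (fun k => ikl k l * c k) J.
Proof.
elim: l => [|i l IH] /=.
  by apply/funext => x; apply: eq_bigr => k _; rewrite /ikl big_nil mul1r.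
rewrite IH cpartial_sum; last by move=> k; exact: csmooth_chrZ.
apply/funext => x; apply: eq_bigr => k _.
rewrite cpartialZ; last exact: chr_csmooth.
by rewrite cpartial_chr /ikl big_cons; ring.
Qed.

Lemma cpartialsB phi psi l : csmooth phi -> csmooth psi ->
  cpartials l (fun x => phi x + -1 * psi x) =
  fun x => cpartials l phi x + -1 * cpartials l psi x.
Proof.
move=> sp sq; elim: l => [//|i l IH] /=; rewrite IH.
have s1 := csmooth_cpartials l sp; have s2 := csmooth_cpartials l sq.
by rewrite (cpartialD i s1 (csmoothM (csmooth_cst (-1)) s2)) (cpartialZ (-1) i s2).
Qed.

(** Controls the truncation error in the seminorms appearing in [is_distribution]: derivatives of a
    truncation are truncations of the series of the derivative, and inversion applies to that
    derivative. *)
Lemma fpart_tail phi l J A : smooth_torus phi ->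
  (forall k, normc (fc phi k) * (1 + knorm k) ^+ size l <= A * wt k) ->
  forall x, normc (cpartials l (fun x => phi x + -1 * fpart (fc phi) J x) x) <=
    2 * A * tail N J.
Proof.
move=> sp HA x; have := fpart_smooth (fc phi) J => sS.
rewrite cpartialsB; [|by case/smooth_torusP: sp|by case/smooth_torusP: sS].
rewrite cpartials_fpart; have sl := smooth_torus_cpartials l sp.
rewrite -(fourier_inversion sl) mulN1r.
have E : fc (cpartials l phi) = fun k => ikl k l * fc phi k.
  by apply/funext => k; exact: fc_cpartials.
rewrite E; apply: lsum_tail; apply: dom_chr => k.
rewrite normcM mulrC; apply: le_trans (HA k).
by rewrite ler_wpM2l ?normc_ge0//; exact: normc_ikl.
Qed.

End FourierSeries.

(** * Distributions determined by their values on characters *)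

Section TorusDistributions.
Context {R : realType} {N : nat}.
Implicit Types (u w : functional R N) (phi psi f : 'rV[R]_N -> R[i]).

Lemma distD u phi psi : is_distribution u -> smooth_torus phi -> smooth_torus psi ->
  u (fun x => phi x + psi x) = u phi + u psi.
Proof.
move=> [lin _] sp sq; have := lin 1 phi psi sp sq; rewrite mul1r => <-.
by congr u; apply/funext => x; rewrite mul1r.
Qed.

Lemma dist0 u : is_distribution u -> u (fun=> 0) = 0.
Proof.
move=> du; have s0 := @smooth_torus_cst R N 0.
have := distD du s0 s0; rewrite addr0 => /eqP.
by rewrite -subr_eq0 opprD addrA subrr sub0r oppr_eq0 => /eqP.
Qed.

Lemma distZ u c phi : is_distribution u -> smooth_torus phi ->
  u (fun x => c * phi x) = c * u phi.
Proof.
move=> du sp; have := du.1 c phi _ sp (@smooth_torus_cst R N 0).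
by rewrite (dist0 du) addr0 => <-; congr u; apply/funext => x; rewrite addr0.
Qed.

Lemma smooth_torus_sum (I : Type) (s : seq I) (F : I -> 'rV[R]_N -> R[i]) :
  (forall i, smooth_torus (F i)) -> smooth_torus (fun x => \sum_(i <- s) F i x).
Proof.
move=> sF; elim: s => [|i s IH].
  by under eq_fun do rewrite big_nil; exact: smooth_torus_cst.
by under eq_fun do rewrite big_cons; exact: smooth_torusD.
Qed.

Lemma dist_sum u (I : Type) (s : seq I) (F : I -> 'rV[R]_N -> R[i]) :
  is_distribution u -> (forall i, smooth_torus (F i)) ->
  u (fun x => \sum_(i <- s) F i x) = \sum_(i <- s) u (F i).
Proof.
move=> du sF; elim: s => [|i s IH].
  by under eq_fun do rewrite big_nil; rewrite big_nil dist0.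
rewrite big_cons -IH -distD//; last exact: smooth_torus_sum.
by congr u; apply/funext => x; rewrite big_cons.
Qed.

Lemma smooth_torus_chrZ (c : R[i]) k : smooth_torus (fun x : 'rV[R]_N => c * chr k x).
Proof. by apply: smooth_torusM; [exact: smooth_torus_cst|exact: smooth_torus_chr]. Qed.

Lemma cpartials_chr (k : 'rV[int]_N) l :
  cpartials l (chr k) = fun x : 'rV[R]_N => ikl k l * chr k x.
Proof.
elim: l => [|i l IH] /=; first by apply/funext => x; rewrite /ikl big_nil mul1r.
rewrite IH cpartialZ; last exact: chr_csmooth.
by rewrite cpartial_chr; apply/funext => x; rewrite /ikl big_cons; ring.
Qed.

Lemma dist_chr_growth u : is_distribution u -> exists (C : R) (m : nat),
  forall k, normc (u (chr k)) <= C * (1 + knorm k) ^+ m.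
Proof.
move=> [_ [C [m H]]]; exists C, m => k.
rewrite -lecR -norm_normc; apply: H; first exact: smooth_torus_chr.
move=> l lm x; rewrite le_normc_lec cpartials_chr normcM normc_chr mulr1.
apply: le_trans (normc_ikl k l) _; apply: ler_weXn2l => //.
by rewrite lerDl knorm_ge0.
Qed.

(** The truncations of the series of [phi] converge to it in the seminorm of order [m] that controls
    [u], so [u] passes through the sum. *)
Lemma dist_fourier u phi : is_distribution u -> smooth_torus phi ->
  u phi = lsum (fun k => fc phi k * u (chr k)).
Proof.
move=> du sp; have [_ [C [m H]]] := du.
have [C' [m' H']] := dist_chr_growth du.
have rc := fc_rapid sp.
have [A HA] := rapid_wt m rc.
have [B HB] := rapid_dom (rapidM rc H').
apply: (@lsum_eq _ _ _ B _ (C * (2 * A))).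
  by move=> k; rewrite mulrC.
move=> J.
have sS := fpart_smooth (fc phi) J.
have -> : psum (fun k => fc phi k * u (chr k)) J = u (fpart (fc phi) J).
  rewrite dist_sum//; last by move=> k; exact: smooth_torus_chrZ.
  by apply: eq_bigr => k _; rewrite distZ//; exact: smooth_torus_chr.
rewrite -mulN1r -distZ// -distD//; last first.
  by apply: smooth_torusM => //; exact: smooth_torus_cst.
rewrite -lecR -norm_normc -mulrA; apply: H.
  by apply: smooth_torusD => //; apply: smooth_torusM => //; exact: smooth_torus_cst.
move=> l lm x; rewrite le_normc_lec; apply: fpart_tail => // k.
apply: le_trans (HA k); rewrite ler_wpM2l ?normc_ge0//; apply: ler_weXn2l => //.
by rewrite lerDl knorm_ge0.
Qed.

Lemma function_is_distribution f : smooth_torus f ->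
  is_distribution (fun phi => torus_cint (fun x => f x * phi x)).
Proof.
move=> sf; have cf := smooth_torus_continuous sf; split.
  move=> c phi psi /smooth_torus_continuous cp /smooth_torus_continuous cq.
  rewrite -torus_cintZ; last exact: ccontinuousM.
  rewrite -torus_cintD; last 2 first.
  - by apply: ccontinuousM; [exact: ccontinuous_cst|exact: ccontinuousM].
  - exact: ccontinuousM.
  by congr torus_cint; apply/funext => x; ring.
have [|M HM] := torus_bounded cf; first by case/smooth_torusP: sf.
exists (2 * M * (2 * pi) ^+ N), 0%N => phi K sp HK.
have -> : 2 * M * (2 * pi) ^+ N * K = 2 * (M * K) * (2 * pi) ^+ N by ring.
rewrite le_normc_lec; apply: normc_torus_cint.
  by apply: ccontinuousM => //; exact: smooth_torus_continuous.
move=> x; rewrite normcM ler_pM ?normc_ge0//.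
by rewrite -le_normc_lec; exact: (HK [::]).
Qed.

(** Both [u] and the candidate function act on [phi] through their values on characters by
    [dist_fourier], and these values agree. *)
Lemma dist_smooth_of_rapid u : is_distribution u -> rapid (fun k => u (chr k)) ->
  dist_smooth u.
Proof.
move=> du ru.
(* The sign: the coefficient at [k] is obtained by testing against [chr (- k)]. *)
pose c k := ((2 * pi) ^- N)%:C * u (chr (- k)).
have rc : rapid c.
  move=> m; have [A HA] := ru m; exists (((2 * pi) ^- N) * A) => k.
  have p0 : 0 <= (2 * pi : R) ^- N by rewrite invr_ge0 exprn_ge0// ltW// twopi_gt0.
  rewrite normcM normc_real ger0_norm// -mulrA ler_wpM2l//.
  by have := HA (- k); rewrite knormN.
exists (fseries c); first exact: fseries_smooth.
have sF := fseries_smooth rc.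
move=> phi sp; rewrite (dist_fourier du sp) (dist_fourier (function_is_distribution sF) sp).
congr lsum; apply/funext => k; congr (_ * _).
by rewrite torus_cint_chr fc_fseries// /c opprK mulrA [_%:C * _%:C]mulrC twopiXK mul1r.
Qed.

Lemma represents_fc u f k : represents f u ->
  fc f k = ((2 * pi) ^- N)%:C * u (chr (- k)).
Proof. by move=> /(_ _ (smooth_torus_chr (- k))) ->. Qed.

(** [xget] picks some representing function; all of them have the same Fourier coefficients and so
    coincide. *)
Lemma value_at_represents u f s : smooth_torus f -> represents f u -> value_at u s = f s.
Proof.
move=> sf rf; rewrite /value_at; case: xgetP => [z _ [g [sg rg ->]]|/(_ (f s))].
  suff -> : g = f by [].
  by apply: fc_inj => //; apply/funext => k; rewrite (represents_fc _ rf) (represents_fc _ rg).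
by move=> H; exfalso; apply: H; exists f.
Qed.

End TorusDistributions.

(** * Joint frequencies in [t] and [x] *)

Section JointFrequencies.
Context {R : realType} {n : nat}.

Definition kapp (k : 'rV[int]_n) (xi : int) : 'rV[int]_(n + 1) := row_mx k xi%:M.

Lemma kapp_lshift k xi j : kapp k xi 0 (lshift 1 j) = k 0 j.
Proof. by rewrite row_mxEl. Qed.

Lemma kapp_rshift k xi : kapp k xi 0 (rshift n ord0) = xi.
Proof. by rewrite row_mxEr mxE eqxx. Qed.

Lemma kappD k l xi eta : kapp k xi + kapp l eta = kapp (k + l) (xi + eta).
Proof. by rewrite /kapp add_row_mx raddfD. Qed.

Lemma kapp_surj (K : 'rV[int]_(n + 1)) : exists k xi, K = kapp k xi.
Proof.
exists (lsubmx K), (rsubmx K 0 0); rewrite -[LHS]hsubmxK; congr row_mx.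
by apply/matrixP => i j; rewrite !ord1 [RHS]mxE eqxx.
Qed.

Lemma chr_kapp k xi (z : 'rV[R]_(n + 1)) :
  chr (kapp k xi) z = chr k (tvar z) * expi (xi%:~R * xvar z).
Proof.
rewrite /chr big_split_ord /= expiD big_ord1; congr (expi _ * expi _).
  by apply: eq_bigr => i _; rewrite kapp_lshift mxE.
by rewrite kapp_rshift /xvar mxE.
Qed.

Lemma knorm_kapp k xi : knorm (kapp k xi) = knorm k + `|xi%:~R| :> R.
Proof.
rewrite /knorm big_split_ord big_ord1 kapp_rshift; congr (_ + _).
by apply: eq_bigr => i _; rewrite kapp_lshift.
Qed.

Lemma knorm_kapp_gek k xi : 1 + knorm k <= 1 + knorm (kapp k xi) :> R.
Proof. by rewrite knorm_kapp addrA lerDl. Qed.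

Lemma knorm_kapp_gexi k xi : 1 + `|xi%:~R| <= 1 + knorm (kapp k xi) :> R.
Proof. by rewrite knorm_kapp lerD2l lerDr knorm_ge0. Qed.

Lemma knorm_kapp_le k xi :
  1 + knorm (kapp k xi) <= (1 + knorm k) * (1 + `|xi%:~R|) :> R.
Proof.
rewrite knorm_kapp mulrDl mul1r mulrDr mulr1.
by have := mulr_ge0 (@knorm_ge0 R n k) (normr_ge0 (xi%:~R : R)); lra.
Qed.

Lemma tvar_line_l h (z : 'rV[R]_(n + 1)) j :
  tvar (h *: delta_mx 0 (lshift 1 j) + z) = h *: delta_mx 0 j + tvar z.
Proof.
by apply/rowP => i; rewrite !mxE (inj_eq (@lshift_inj _ _)).
Qed.

Lemma tvar_line_r h (z : 'rV[R]_(n + 1)) :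
  tvar (h *: delta_mx 0 (rshift n ord0) + z) = tvar z.
Proof.
by apply/rowP => i; rewrite !mxE eq_lrshift /= mulr0 add0r.
Qed.

Lemma tvar_continuous : continuous (@tvar R n).
Proof. by move=> z; exact: continuous_lsubmx. Qed.

Lemma tvar_quotient_l (f : 'rV[R]_n -> R) j (z : 'rV[R]_(n + 1)) :
  (fun h : R => h^-1 *: (f (tvar (h *: delta_mx 0 (lshift 1 j) + z)) - f (tvar z))) =
  (fun h : R => h^-1 *: (f (h *: delta_mx 0 j + tvar z) - f (tvar z))).
Proof. by apply/funext => h; rewrite tvar_line_l. Qed.

Lemma partial_tvar_l (f : 'rV[R]_n -> R) j :
  partial (lshift 1 j) (fun z => f (tvar z)) = fun z => partial j f (tvar z).
Proof. by apply/funext => z; rewrite /partial /derive tvar_quotient_l. Qed.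

Lemma derivable_tvar_l (f : 'rV[R]_n -> R) j z :
  derivable f (tvar z) (delta_mx 0 j) ->
  derivable (fun z => f (tvar z)) z (delta_mx 0 (lshift 1 j)).
Proof. by rewrite /derivable tvar_quotient_l. Qed.

Lemma is_derive_tvar_r (f : 'rV[R]_n -> R) (z : 'rV[R]_(n + 1)) :
  is_derive z (delta_mx 0 (rshift n ord0)) (fun z => f (tvar z)) 0.
Proof.
have E : (fun h : R => h^-1 *: (f (tvar (h *: delta_mx 0 (rshift n ord0) + z)) - f (tvar z)))
    = fun=> 0.
  by apply/funext => h; rewrite tvar_line_r subrr scaler0.
have L : (fun h : R => h^-1 *: (f (tvar (h *: delta_mx 0 (rshift n ord0) + z)) - f (tvar z)))
  @ 0^' --> (0 : R) by rewrite E; exact: cvg_cst.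
by apply: DeriveDef; [apply/cvg_ex; exists 0|exact: cvg_lim L].
Qed.

Lemma cpartial_tvar_l (F : 'rV[R]_n -> R[i]) j :
  cpartial (lshift 1 j) (fun z => F (tvar z)) = fun z => cpartial j F (tvar z).
Proof.
apply/funext => z; rewrite /cpartial; congr (_ +i* _).
  by have /(congr1 (@^~ z)) := partial_tvar_l (re F) j.
by have /(congr1 (@^~ z)) := partial_tvar_l (im F) j.
Qed.

Lemma cpartial_tvar_r (F : 'rV[R]_n -> R[i]) :
  cpartial (rshift n ord0) (fun z => F (tvar z)) = fun=> 0.
Proof.
apply/funext => z; apply: complexP => /=.
  by case: (is_derive_tvar_r (re F) z).
by case: (is_derive_tvar_r (im F) z).
Qed.

Lemma csmooth_tvar (F : 'rV[R]_n -> R[i]) : csmooth F -> csmooth (fun z => F (tvar z)).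
Proof.
move=> sF; apply: (@csmooth_coind _ _ (fun G => exists2 H, csmooth H & G = fun z => H (tvar z)));
  last by exists F.
move=> _ [H sH ->]; split.
- exact: ccontinuous_comp tvar_continuous (csmooth_continuous sH).
- move=> i z; case: (split_ordP i) => j ->.
    split.
      exact: (@derivable_tvar_l (re H) j z (smooth_derivable sH.1)).
    exact: (@derivable_tvar_l (im H) j z (smooth_derivable sH.2)).
  rewrite ord1; split; first by case: (is_derive_tvar_r (re H) z).
  by case: (is_derive_tvar_r (im H) z).
- move=> i; case: (split_ordP i) => j ->.
    exists (cpartial j H); first exact: csmooth_cpartial.
    exact: cpartial_tvar_l.
  exists (fun=> 0); first exact: csmooth_cst.
  by rewrite ord1 cpartial_tvar_r.
Qed.

Lemma smooth_torus_tvar (F : 'rV[R]_n -> R[i]) :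
  smooth_torus F -> smooth_torus (fun z => F (tvar z)).
Proof.
move=> /smooth_torusP[sF pF]; apply/smooth_torusP; split; first exact: csmooth_tvar.
move=> i z; rewrite addrC; case: (split_ordP i) => j ->.
  by rewrite tvar_line_l addrC pF.
by rewrite ord1 tvar_line_r.
Qed.

Lemma cpartialsD (N : nat) (F G : 'rV[R]_N -> R[i]) l : csmooth F -> csmooth G ->
  cpartials l (fun x => F x + G x) = fun x => cpartials l F x + cpartials l G x.
Proof.
move=> sF sG; elim: l => [//|i l IH] /=; rewrite IH.
exact: (cpartialD i (csmooth_cpartials l sF) (csmooth_cpartials l sG)).
Qed.

Lemma cpartialsZ (N : nat) (c : R[i]) (F : 'rV[R]_N -> R[i]) l : csmooth F ->
  cpartials l (fun x => c * F x) = fun x => c * cpartials l F x.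
Proof.
move=> sF; elim: l => [//|i l IH] /=; rewrite IH.
exact: (cpartialZ c i (csmooth_cpartials l sF)).
Qed.

(** Test functions with a fixed frequency [K] and a profile in [t]. For fixed [K], the functional
    [psi |-> u (modulated K psi)] is a distribution on the smaller torus, so its profile can be
    expanded in characters. *)
Definition modulated (K : 'rV[int]_(n + 1)) (psi : 'rV[R]_n -> R[i]) : 'rV[R]_(n + 1) -> R[i] :=
  fun z => psi (tvar z) * chr K z.

Lemma smooth_torus_modulated K psi : smooth_torus psi -> smooth_torus (modulated K psi).
Proof.
by move=> sp; apply: smooth_torusM; [exact: smooth_torus_tvar|exact: smooth_torus_chr].
Qed.

Lemma cpartial_modulated_l K psi j : csmooth psi ->
  cpartial (lshift 1 j) (modulated K psi) =
  fun z => modulated K (cpartial j psi) z + ik K (lshift 1 j) * modulated K psi z.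
Proof.
move=> sp; rewrite /modulated (cpartialM _ (csmooth_tvar sp) (chr_csmooth K)).
rewrite cpartial_tvar_l cpartial_chr; apply/funext => z; congr (_ + _).
exact: mulrCA.
Qed.

Lemma cpartial_modulated_r K psi : csmooth psi ->
  cpartial (rshift n ord0) (modulated K psi) =
  fun z => ik K (rshift n ord0) * modulated K psi z.
Proof.
move=> sp; rewrite /modulated (cpartialM _ (csmooth_tvar sp) (chr_csmooth K)).
rewrite cpartial_tvar_r cpartial_chr; apply/funext => z.
by rewrite mul0r add0r mulrCA.
Qed.

Lemma csmooth_modulated K psi : csmooth psi -> csmooth (modulated K psi).
Proof. by move=> sp; apply: csmoothM; [exact: csmooth_tvar|exact: chr_csmooth]. Qed.

(** Each derivative falls on [psi] or produces a factor of modulus at most [1 + |K|], hence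
    [2 + |K|] per derivative. The induction removes the innermost derivative, which changes
    [psi]. *)
Lemma cpartials_modulated_le K psi M l : csmooth psi ->
  (forall l' : seq 'I_n, (size l' <= size l)%N -> forall x, normc (cpartials l' psi x) <= M) ->
  forall z, normc (cpartials l (modulated K psi) z) <= (2 + knorm K) ^+ size l * M.
Proof.
have K2 : 1 <= 2 + knorm K :> R by have := @knorm_ge0 R _ K; lra.
elim/last_ind: l psi M => [|l i IH] psi M sp HM z.
  by rewrite expr0 mul1r /= normcM normc_chr mulr1; exact: (HM [::]).
have M0 : 0 <= M by apply: le_trans (normc_ge0 _) (HM [::] _ 0).
have E (F : 'rV[R]_(n + 1) -> R[i]) : cpartials (rcons l i) F = cpartials l (cpartial i F).
  by rewrite /cpartials foldr_rcons.
have HMl (l' : seq 'I_n) : (size l' <= size l)%N -> forall x, normc (cpartials l' psi x) <= M.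
  by move=> sl; apply: HM; rewrite size_rcons leqW.
have B0 := IH _ _ sp HMl z.
have B1 : normc (ik K i * cpartials l (modulated K psi) z) <=
    (1 + knorm K) * ((2 + knorm K) ^+ size l * M).
  by rewrite normcM ler_pM ?normc_ge0// normc_ik_le.
rewrite E size_rcons exprS -mulrA.
have fin : (1 + knorm K) * ((2 + knorm K) ^+ size l * M) + (2 + knorm K) ^+ size l * M
   <= (2 + knorm K) * ((2 + knorm K) ^+ size l * M).
  by rewrite le_eqVlt; apply/orP; left; apply/eqP; ring.
apply: le_trans fin.
have sm := csmooth_modulated K sp.
case: (split_ordP i) => j iE; subst i.
  have sj := csmooth_cpartial j sp.
  rewrite cpartial_modulated_l// cpartialsD; first last.
    by apply: csmoothM => //; exact: csmooth_cst.
    exact: csmooth_modulated.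
  rewrite cpartialsZ//; apply: le_trans (normcD _ _) _; rewrite addrC; apply: lerD => //.
  apply: IH => // l' sl x.
  have := HM (rcons l' j); rewrite !size_rcons => /(_ sl x).
  by rewrite /cpartials foldr_rcons.
rewrite ord1 in B1 *; rewrite cpartial_modulated_r// cpartialsZ//.
apply: le_trans B1 _; rewrite lerDl mulr_ge0// exprn_ge0//; lra.
Qed.

Lemma modulated_distribution (u : functional R (n + 1)) K : is_distribution u ->
  is_distribution (fun psi => u (modulated K psi)).
Proof.
move=> du; have [lin [C [m H]]] := du; split.
  move=> c phi psi sp sq.
  rewrite -lin; try exact: smooth_torus_modulated.
  by congr u; apply/funext => z; rewrite /modulated mulrDl mulrA.
exists (C * (2 + knorm K) ^+ m), m => psi M sp HM.
rewrite -mulrA; apply: H; first exact: smooth_torus_modulated.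
have K2 : 1 <= 2 + knorm K :> R by have := @knorm_ge0 R _ K; lra.
move=> l lm z; rewrite le_normc_lec.
have M0 : 0 <= M.
  by apply: (le_trans (normc_ge0 (psi 0))); rewrite -le_normc_lec; exact: (HM [::]).
apply: le_trans (_ : (2 + knorm K) ^+ size l * M <= _).
  apply: cpartials_modulated_le; first by case/smooth_torusP: sp.
  by move=> l' sl x; rewrite -le_normc_lec; apply: HM; exact: leq_trans lm.
by rewrite ler_wpM2r//; apply: ler_weXn2l.
Qed.

Lemma modulated_chr K k : modulated K (chr k) = chr (kapp k 0 + K).
Proof.
apply/funext => z; rewrite /modulated chrD; congr (_ * _).
by rewrite chr_kapp mul0r expi0 mulr1.
Qed.

End JointFrequencies.

(** * Propagation and bootstrap *)

Section PropagationAlongLines.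
Context {R : realType} {n : nat}.
Implicit Types (g h : 'rV[R]_n -> R[i]).

(* The purely imaginary zeroth-order term does not change [|g|], so that
   [|g|^2 exp (- r) - H^2 r] decreases along the coordinate lines. *)
Lemma coordinate_step (g : 'rV[R]_n -> R[i]) (b : 'rV[R]_n -> R) j (H : R) :
  csmooth g ->
  (forall x, normc (cpartial j g x + (0 +i* b x) * g x) <= H) ->
  forall x (r : R), 0 <= r <= 2 * pi ->
  normc (g (r *: delta_mx 0 j + x)) ^+ 2 <=
    expR (2 * pi) * (1 + 2 * pi) * (normc (g x) ^+ 2 + H ^+ 2).
Proof.
move=> [sr si] hH x r /andP[r0 r1].
pose e : 'rV[R]_n := delta_mx 0 j.
pose p (s : R) := re g (s *: e + x).
pose q (s : R) := im g (s *: e + x).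
pose dp (s : R) := partial j (re g) (s *: e + x).
pose dq (s : R) := partial j (im g) (s *: e + x).
have hp (s : R) : is_derive s 1 p (dp s) by apply: line_derive; exact: smooth_derivable.
have hq (s : R) : is_derive s 1 q (dq s) by apply: line_derive; exact: smooth_derivable.
pose E (s : R) := expR (- s).
have hE (s : R) : is_derive s 1 E (- E s).
  rewrite /E; have := is_derive1_comp (f := expR) (g := -%R) (x := s).
  move=> /(_ _ _ (is_derive_expR _) (is_deriveNid _ _)).
  by rewrite mulrN1.
pose Q (s : R) := (p s * p s + q s * q s) * E s - H ^+ 2 * s.
pose dQ (s : R) := (2 * (p s * dp s + q s * dq s) - (p s * p s + q s * q s)) * E s - H ^+ 2.
have hQ (s : R) : is_derive s 1 Q (dQ s).
  have d1 : is_derive s 1 ((p * p + q * q) * E - (fun t : R => H ^+ 2 * t)) (dQ s).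
    have dH : is_derive s 1 (fun t : R => H ^+ 2 * t) (H ^+ 2).
      have := is_deriveZ (H ^+ 2) (is_derive_id s (1 : R)).
      by rewrite [_ *: 1]mulr1.
    apply: is_derive_eq.
    by rewrite /dQ -[(_ + _) s]/(p s * p s + q s * q s) -![_ *: _]/(_ * _); ring.
  exact: d1.
have cQ : continuous Q.
  by move=> s; apply: differentiable_continuous; apply/derivable1_diffP; case: (hQ s).
have [c] := @MVT_segment _ Q dQ 0 r r0 (fun s _ => hQ s) (continuous_subspaceT cQ).
rewrite in_itv/= => /andP[c0 cr]; rewrite subr0 => EQ.
have E1 (s : R) : 0 <= s -> E s <= 1 by move=> s0; rewrite /E -expR0 ler_expR oppr_le0.
have E0 (s : R) : 0 < E s by exact: expR_gt0.
have H0 : 0 <= H by apply: le_trans (hH x); exact: normc_ge0.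
have dQc : dQ c <= 0.
  have := hH (c *: e + x); set z := c *: e + x => hz.
  have hz2 : normc (cpartial j g z + (0 +i* b z) * g z) ^+ 2 <= H ^+ 2.
    by rewrite ler_pXn2r ?nnegrE ?normc_ge0.
  move: hz2; rewrite normc_sqr cReD cImD cReM cImM /= -/(re g) -/(im g).
  rewrite -[complex.Re (g z)]/(p c) -[complex.Im (g z)]/(q c).
  rewrite -[partial j (re g) z]/(dp c) -[partial j (im g) z]/(dq c).
  rewrite /dQ; move: (p c) (q c) (dp c) (dq c) (b z) (E0 c) (E1 c c0) => P1 P2 D1 D2 B Ec0 Ec1 hz2.
  (* With [w = dg + i b g], the term [i b g] is orthogonal to [g] in the plane, so the inner product
     of [g] and [dg] is that of [g] and [w]; the bound is then [|g - w|^2 >= 0]. *)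
  have K : 2 * (P1 * D1 + P2 * D2) - (P1 * P1 + P2 * P2) <= H ^+ 2.
    apply: le_trans hz2.
    rewrite -subr_ge0 (_ : _ - _ = (P1 - (D1 + (0 * P1 - B * P2))) ^+ 2 +
       (P2 - (D2 + (0 * P2 + B * P1))) ^+ 2); last by ring.
    by rewrite addr_ge0// sqr_ge0.
  rewrite subr_le0; apply: (@le_trans _ _ (H ^+ 2 * E c)).
    by rewrite ler_wpM2r// ltW.
  by rewrite ler_piMr// sqr_ge0.
have Qr : Q r <= Q 0 by rewrite -subr_le0 EQ mulr_le0_ge0.
have gr : normc (g (r *: e + x)) ^+ 2 = p r * p r + q r * q r.
  by rewrite normc_sqr !expr2.
have gx : normc (g x) ^+ 2 = p 0 * p 0 + q 0 * q 0.
  by rewrite normc_sqr !expr2 /p /q scale0r add0r.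
rewrite gr gx.
move: Qr; rewrite /Q /E oppr0 expR0 mulr1 mulr0 subr0.
have G0 : 0 <= p 0 * p 0 + q 0 * q 0 by rewrite -!expr2 addr_ge0// sqr_ge0.
have Gr : 0 <= p r * p r + q r * q r by rewrite -!expr2 addr_ge0// sqr_ge0.
move: (p r * p r + q r * q r) (p 0 * p 0 + q 0 * q 0) G0 Gr => Yr Y0 HY0 HYr HQ.
have HH : 0 <= H ^+ 2 by exact: sqr_ge0.
have S1 : Yr * expR (- r) <= (1 + 2 * pi) * (Y0 + H ^+ 2).
  have t0 : 0 <= 2 * pi :> R by rewrite ltW// twopi_gt0.
  have m1 : H ^+ 2 * r <= 2 * pi * H ^+ 2 by rewrite mulrC ler_wpM2r.
  have m2 : 0 <= 2 * pi * Y0 by exact: mulr_ge0.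
  by rewrite mulrDl mul1r mulrDr; lra.
have -> : Yr = expR r * (Yr * expR (- r)).
  by rewrite mulrCA -expRD subrr expR0 mulr1.
rewrite -mulrA; apply: ler_pM => //.
  by rewrite mulr_ge0// expR_ge0.
by rewrite ler_expR.
Qed.

(** Periodicity brings any [r] into [[0, 2 pi]], so the constant does not depend on the distance
    travelled. *)
Lemma torus_step (g : 'rV[R]_n -> R[i]) (b : 'rV[R]_n -> R) j (H : R) :
  smooth_torus g ->
  (forall x, normc (cpartial j g x + (0 +i* b x) * g x) <= H) ->
  forall x (r : R),
  normc (g (x + r *: delta_mx 0 j)) ^+ 2 <=
    expR (2 * pi) * (1 + 2 * pi) * (normc (g x) ^+ 2 + H ^+ 2).
Proof.
move=> /smooth_torusP[sg pg] hH x r.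
have t0 := @twopi_gt0 R.
pose m := Num.floor (r / (2 * pi)).
have -> : g (x + r *: delta_mx 0 j) = g ((r - m%:~R * (2 * pi)) *: delta_mx 0 j + x).
  by rewrite -[RHS](periodic_int j m _ pg) addrAC -scalerDl subrK addrC.
apply: coordinate_step => //; apply/andP; split.
  by rewrite subr_ge0 -ler_pdivlMr// floor_le.
by rewrite lerBlDl -{2}[2 * pi]mul1r -mulrDl -ler_pdivrMr// ltW// -[1]/(1%:~R) -intrD floorD1_gt.
Qed.

(** [K] is chosen before [g] and [b], so it stays fixed when [b] grows like [xi]. The coordinates of
    [s] are changed into those of [x] one at a time; each move multiplies by [K0] and adds a fresh
    [H ^+ 2], both absorbed in a factor [2 * K0]. *)
Lemma torus_propagation : exists2 K : R, 0 < K &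
  forall (g : 'rV[R]_n -> R[i]) (b : 'I_n -> 'rV[R]_n -> R) (H : R) s,
  smooth_torus g -> 0 <= H ->
  (forall j x, normc (cpartial j g x + (0 +i* b j x) * g x) <= H) ->
  forall x, normc (g x) <= K * (normc (g s) + H).
Proof.
pose K0 : R := expR (2 * pi) * (1 + 2 * pi).
have t0 := @twopi_gt0 R.
have K01 : 1 <= K0.
  have e1 : 1 <= expR (2 * pi) :> R by rewrite -[leLHS]expR0 ler_expR ltW.
  by apply: (le_trans e1); rewrite ler_peMr ?expR_ge0// lerDl ltW.
pose L := (2 * K0) ^+ size (index_enum 'I_n).
have L1 : 1 <= L by rewrite exprn_ege1//; lra.
exists L => [|g b H s sg H0 hH x]; first lra.
have P (l : seq 'I_n) : normc (g (s + \sum_(i <- l) (x 0 i - s 0 i) *: delta_mx 0 i)) ^+ 2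
    <= (2 * K0) ^+ size l * (normc (g s) ^+ 2 + H ^+ 2).
  elim: l => [|i l IH]; first by rewrite big_nil addr0 expr0 mul1r lerDl sqr_ge0.
  rewrite big_cons addrCA addrC; apply: le_trans (torus_step sg (hH i) _ _) _.
  rewrite -/K0; set S := normc (g s) ^+ 2 + H ^+ 2 in IH *.
  rewrite [in leRHS]exprS.
  have -> : 2 * K0 * (2 * K0) ^+ size l * S = K0 * (2 * ((2 * K0) ^+ size l * S)) by ring.
  rewrite ler_wpM2l//; first lra.
  rewrite mulr_natl mulr2n; apply: lerD => //.
  apply: (@le_trans _ _ S); first by rewrite lerDr sqr_ge0.
  by rewrite ler_peMl ?addr_ge0 ?sqr_ge0// exprn_ege1//; lra.
have := P (index_enum 'I_n).
have -> : s + \sum_i (x 0 i - s 0 i) *: delta_mx 0 i = x.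
  rewrite [X in _ + X](_ : _ = x - s); first by rewrite addrC subrK.
  by rewrite [RHS]row_sum_delta; apply: eq_bigr => i _; rewrite !mxE.
rewrite -/L => Hx.
have N0 := normc_ge0 (g s).
rewrite -(@ler_pXn2r _ 2)// ?nnegrE ?normc_ge0 ?mulr_ge0 ?addr_ge0//; last lra.
apply: le_trans Hx _; rewrite exprMn ler_pM//; first lra.
- by rewrite addr_ge0// sqr_ge0.
- by rewrite expr2 ler_peMl//; lra.
- by rewrite sqrrD addrAC lerDl mulrn_wge0// mulr_ge0.
Qed.

End PropagationAlongLines.

(** * Gain of one power of the frequency in [t] *)

Section Bootstrap.
Context {R : realType} {n : nat}.

(** A Peetre-type inequality: weights move between [k] and [k + l] at the price of powers of
    [1 + |l|]. *)
Lemma knormD_le (k l : 'rV[int]_n) :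
  1 + knorm (k + l) <= (1 + knorm k) * (1 + knorm l) :> R.
Proof.
have := @knormD R n k l; have := mulr_ge0 (@knorm_ge0 R n k) (@knorm_ge0 R n l).
by rewrite mulrDl mul1r mulrDr mulr1; lra.
Qed.

Lemma ler_expn_nneg (x y : R) p : 0 <= x -> x <= y -> x ^+ p <= y ^+ p.
Proof. by move=> x0 xy; apply: lerXn2r => //; rewrite nnegrE//; exact: le_trans xy. Qed.

(* Convolution with rapidly decreasing coefficients preserves the growth order
   of [c], while each [k j * c k] is controlled by such convolutions. *)
Lemma bootstrap (alpha : 'I_n -> 'rV[int]_n -> R[i]) (m q : nat) :
  (forall j, rapid (alpha j)) ->
  exists2 B : R, 0 <= B & forall (c : 'rV[int]_n -> R[i]) (X A D : R),
  0 <= D ->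
  (forall k, normc (c k) * (1 + knorm k) ^+ q <= A * (1 + knorm k) ^+ m) ->
  (forall j k, normc (ik k j * c k + (0 +i* X) * lsum (fun l => alpha j l * c (l + k)))
     * (1 + knorm k) ^+ q <= D) ->
  forall k, normc (c k) * (1 + knorm k) ^+ q.+1 <=
    (A * (1 + B * `|X|) + D *+ n) * (1 + knorm k) ^+ m.
Proof.
move=> ra.
have tn0 := @tail_ge0 R n 0.
have /choice[Da HD] : forall j, exists D : R,
    forall k, normc (alpha j k) * (1 + knorm k) ^+ (m + q) <= D * wt k.
  by move=> j; exact: rapid_wt.
have Da0 j : 0 <= Da j.
  rewrite -(pmulr_lge0 _ (wt_gt0 (0 : 'rV[int]_n))); apply: le_trans (HD j 0).
  by rewrite mulr_ge0 ?normc_ge0// exprn_ge0// ltW// knormP1_gt0.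
(* This bound is chosen from [alpha], [m] and [q] alone, so [X], which will be [xi], enters only
   through the explicit factor [1 + B |X|]. *)
exists (\sum_j 2 * Da j * tail n 0).
  by apply: sumr_ge0 => j _; rewrite !mulr_ge0.
move=> c X A D D0 Hc Heq k.
have k0 := @knormP1_gt0 R n k.
have kq0 p : 0 < (1 + knorm k : R) ^+ p by rewrite exprn_gt0.
have A0 : 0 <= A.
  have := Hc 0; rewrite -(pmulr_lge0 A (exprn_gt0 m (@knormP1_gt0 R n 0))).
  by apply: le_trans; rewrite mulr_ge0 ?normc_ge0// exprn_ge0// ltW// knormP1_gt0.
have conv j : normc (lsum (fun l => alpha j l * c (l + k))) * (1 + knorm k) ^+ q
    <= 2 * Da j * tail n 0 * (A * (1 + knorm k) ^+ m).
  pose S := A * (1 + knorm k) ^+ m / (1 + knorm k) ^+ q.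
  have S0 : 0 <= S by rewrite divr_ge0 ?mulr_ge0// ltW.
  have H l : normc (alpha j l * c (l + k)) <= S * Da j * wt l.
    have l0 := @knormP1_gt0 R n l.
    (* [knormD_le] is used in both directions: [q] powers carry the decay from [l + k] to [k], [m]
       powers carry the growth. The factor [(1 + |l|)^(m + q)] is absorbed by the rapid decrease of
       [alpha j]. *)
    have cS : normc (c (l + k)) <= S * (1 + knorm l) ^+ (m + q).
      rewrite /S mulrAC ler_pdivlMr//.
      apply: (@le_trans _ _ (normc (c (l + k)) * ((1 + knorm (l + k)) ^+ q * (1 + knorm l) ^+ q))).
        rewrite ler_wpM2l ?normc_ge0// -exprMn; apply: ler_expn_nneg.
          exact: ltW.
        have := knormD_le (l + k) (- l); rewrite knormN.
        by rewrite addrAC subrr add0r.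
      rewrite mulrA; apply: (@le_trans _ _ (A * (1 + knorm (l + k)) ^+ m * (1 + knorm l) ^+ q)).
        by rewrite ler_wpM2r// exprn_ge0// ltW.
      have -> : A * (1 + knorm k) ^+ m * (1 + knorm l) ^+ (m + q) =
          A * ((1 + knorm l) ^+ m * (1 + knorm k) ^+ m) * (1 + knorm l) ^+ q.
        by rewrite exprD; ring.
      rewrite ler_wpM2r ?exprn_ge0 ?(ltW l0)// ler_wpM2l// -exprMn.
      apply: ler_expn_nneg; first by rewrite ltW// knormP1_gt0.
      exact: knormD_le.
    rewrite normcM mulrC -mulrA.
    apply: (@le_trans _ _ (S * (1 + knorm l) ^+ (m + q) * normc (alpha j l))).
      by rewrite ler_wpM2r ?normc_ge0.
    by rewrite -mulrA ler_wpM2l// mulrC.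
  apply: (@le_trans _ _ (2 * (S * Da j) * tail n 0 * (1 + knorm k) ^+ q)).
    by rewrite (ler_wpM2r (ltW (kq0 q)))//; exact: (normc_lsum H).
  rewrite le_eqVlt; apply/orP; left; apply/eqP.
  have -> : A * (1 + knorm k) ^+ m = S * (1 + knorm k) ^+ q.
    by rewrite /S divfK// gt_eqF.
  by ring.
have coord j : `|(k 0 j)%:~R| * (normc (c k) * (1 + knorm k) ^+ q) <=
    D + `|X| * (2 * Da j * tail n 0 * (A * (1 + knorm k) ^+ m)).
  pose z := (0 +i* X) * lsum (fun l => alpha j l * c (l + k)).
  have -> : `|(k 0 j)%:~R| * (normc (c k) * (1 + knorm k) ^+ q) =
      normc (ik k j * c k) * (1 + knorm k) ^+ q.
    by rewrite normcM normc_ik mulrA.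
  have -> : ik k j * c k = (ik k j * c k + z) + - z by rewrite addrK.
  apply: (@le_trans _ _ ((normc (ik k j * c k + z) + normc (- z)) * (1 + knorm k) ^+ q)).
    by rewrite (ler_wpM2r (ltW (kq0 q)))//; exact: normcD.
  rewrite mulrDl; apply: lerD; first exact: Heq.
  by rewrite normc_opp normcM normc_i -[leLHS]mulrA ler_wpM2l.
rewrite exprS mulrCA mulrDl mul1r.
have -> : knorm k * (normc (c k) * (1 + knorm k) ^+ q) =
    \sum_i `|(k 0 i)%:~R| * (normc (c k) * (1 + knorm k) ^+ q) by exact: mulr_suml.
apply: (@le_trans _ _ (A * (1 + knorm k) ^+ m +
  \sum_j (D + `|X| * (2 * Da j * tail n 0 * (A * (1 + knorm k) ^+ m))))).
  by apply: lerD => //; apply: ler_sum => j _; exact: coord.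
rewrite big_split/= sumr_const card_ord -mulr_sumr -mulr_suml.
have K1 : 1 <= (1 + knorm k : R) ^+ m by rewrite exprn_ege1// lerDl knorm_ge0.
have Dn : D *+ n <= D *+ n * (1 + knorm k) ^+ m.
  by rewrite ler_peMr// mulrn_wge0.
move: Dn; set V := D *+ n => Dn; set T := \sum_j _.
rewrite -subr_ge0 (_ : _ - _ = V * (1 + knorm k) ^+ m - V) ?subr_ge0//.
by ring.
Qed.

End Bootstrap.

(** * The system of vector fields *)

Section VectorFieldSystem.
Context {R : realType} {n : nat}.

(** Since [a j] does not depend on [x], the derivative in [x] of [a j] times a character is [i xi]
    times that product; no derivative of [a j] appears. *)
Lemma field_equation (a : 'I_n -> 'rV[R]_n -> R) (u : functional R (n + 1)) j
    (f : 'rV[R]_(n + 1) -> R[i]) (k : 'rV[int]_n) (xi : int) :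
  is_distribution u -> smooth_torus_real (a j) ->
  represents f (vector_field a j u) ->
  ik k j * u (chr (kapp k xi)) +
    (0 +i* xi%:~R) * u (modulated (kapp k xi) (fun x => (a j x)%:C)) =
  - torus_cint (fun z => f z * chr (kapp k xi) z).
Proof.
move=> du [sa pa] rf; set K := kapp k xi.
have sE := @smooth_torus_chr R _ K.
have saC : smooth_torus (fun x => (a j x)%:C).
  apply/smooth_torusP; split; first exact: csmooth_real.
  by move=> i x; rewrite pa.
have sM := smooth_torus_modulated K saC.
rewrite -(rf _ sE) /vector_field /dist_add /dist_mul /dist_partial opprD !opprK.
congr (_ + _).
  by rewrite cpartial_chr distZ// /ik kapp_lshift.
rewrite -/(modulated K (fun x => (a j x)%:C)) cpartial_modulated_r; last first.
  exact: csmooth_real.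
by rewrite distZ// /ik kapp_rshift.
Qed.

Lemma modulated_expansion (u : functional R (n + 1)) (phi : 'rV[R]_n -> R[i]) k xi :
  is_distribution u -> smooth_torus phi ->
  u (modulated (kapp k xi) phi) =
  lsum (fun l => fc phi l * u (chr (kapp (l + k) xi))).
Proof.
move=> du sp; rewrite (dist_fourier (modulated_distribution (kapp k xi) du) sp).
by congr lsum; apply/funext => l; rewrite modulated_chr kappD add0r.
Qed.

(** The sign of [eta] flips because [partial_fourier] tests against [exp (- i x eta)]. *)
Lemma partial_fourierE (u : functional R (n + 1)) eta psi :
  partial_fourier u eta psi = ((2 * pi)^-1)%:C * u (modulated (kapp 0 (- eta)) psi).
Proof.
rewrite /partial_fourier; congr (_ * u _); apply/funext => z; rewrite /modulated.
by rewrite chr_kapp chr0 mul1r mulrNz mulNr mulrC [xvar z * _]mulrC mulrC.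
Qed.

Lemma distribution_scale N (c : R[i]) (u : functional R N) :
  is_distribution u -> is_distribution (fun psi => c * u psi).
Proof.
move=> [lin [C [m H]]]; split.
  by move=> d phi psi sp sq; rewrite lin// mulrDr mulrCA.
exists (normc c * C), m => phi M sp HM.
rewrite le_normc_lec normcM -mulrA ler_wpM2l ?normc_ge0// -le_normc_lec.
exact: H.
Qed.

Lemma partial_fourier_distribution (u : functional R (n + 1)) eta :
  is_distribution u -> is_distribution (partial_fourier u eta).
Proof.
move=> du; rewrite (funext (partial_fourierE u eta)).
by apply: distribution_scale; exact: modulated_distribution.
Qed.

Lemma partial_fourier_chr (u : functional R (n + 1)) eta k :
  partial_fourier u eta (chr k) = ((2 * pi)^-1)%:C * u (chr (kapp k (- eta))).
Proof. by rewrite partial_fourierE modulated_chr kappD addr0 add0r. Qed.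

Lemma rhs_decay (f : 'I_n -> 'rV[R]_(n + 1) -> R[i]) q M :
  (forall j, smooth_torus (f j)) ->
  exists2 D : R, 0 <= D & forall j k xi,
    normc (torus_cint (fun z => f j z * chr (kapp k xi) z)) * (1 + knorm k) ^+ q *
      (1 + `|xi%:~R|) ^+ M <= D.
Proof.
move=> sf.
have /choice[A HA] : forall j, exists A : R, forall K,
    normc (fc (f j) K) * (1 + knorm K) ^+ (q + M) <= A.
  by move=> j; exact: fc_rapid.
have A0 j : 0 <= A j.
  apply: le_trans (HA j 0); rewrite mulr_ge0 ?normc_ge0// exprn_ge0// ltW//.
  exact: knormP1_gt0.
have t0 : 0 <= (2 * pi : R) ^+ (n + 1) by rewrite exprn_ge0// ltW// twopi_gt0.
exists ((2 * pi) ^+ (n + 1) * \sum_j A j); first by rewrite mulr_ge0// sumr_ge0.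
move=> j k xi; rewrite torus_cint_chr normcM normc_real ger0_norm// -!mulrA.
rewrite ler_wpM2l//; apply: (@le_trans _ _ (A j)); last first.
  by rewrite (bigD1 j)//= lerDl sumr_ge0.
apply: le_trans (HA j (- kapp k xi)); rewrite ler_wpM2l ?normc_ge0//.
rewrite knormN exprD ler_pM ?exprn_ge0 ?addr_ge0 ?knorm_ge0//.
  apply: ler_expn_nneg; last exact: knorm_kapp_gek.
  by rewrite addr_ge0// knorm_ge0.
apply: ler_expn_nneg; last exact: knorm_kapp_gexi.
by rewrite addr_ge0.
Qed.

Lemma fcD N (phi psi : 'rV[R]_N -> R[i]) k : ccontinuous phi -> ccontinuous psi ->
  fc (fun x => phi x + psi x) k = fc phi k + fc psi k.
Proof.
move=> cp cq; have ce := @chr_ccontinuous R N (- k).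
rewrite /fc -mulrDr -torus_cintD; [|exact: ccontinuousM..].
by congr (_ * torus_cint _); apply/funext => x; rewrite mulrDl.
Qed.

Lemma fcZ N c (phi : 'rV[R]_N -> R[i]) k : ccontinuous phi ->
  fc (fun x => c * phi x) k = c * fc phi k.
Proof.
move=> cp; have ce := @chr_ccontinuous R N (- k).
rewrite /fc mulrCA -(torus_cintZ c (ccontinuousM cp ce)).
by congr (_ * torus_cint _); apply/funext => x; rewrite mulrA.
Qed.

Section Solution.
Context (a : 'I_n -> 'rV[R]_n -> R) (u : functional R (n + 1))
  (f : 'I_n -> 'rV[R]_(n + 1) -> R[i]).
Context (ha : forall j, smooth_torus_real (a j)) (hu : is_distribution u)
  (sf : forall j, smooth_torus (f j))
  (rf : forall j, represents (f j) (vector_field a j u)).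

Let U (xi : int) (k : 'rV[int]_n) : R[i] := u (chr (kapp k xi)).
Let ac j : 'rV[R]_n -> R[i] := fun x => (a j x)%:C.

Let smooth_ac j : smooth_torus (ac j).
Proof.
have [sa pa] := ha j; apply/smooth_torusP; split; first exact: csmooth_real.
by move=> i x; rewrite /ac pa.
Qed.

Let U_equation j k xi :
  ik k j * U xi k + (0 +i* xi%:~R) * lsum (fun l => fc (ac j) l * U xi (l + k)) =
  - torus_cint (fun z => f j z * chr (kapp k xi) z).
Proof.
rewrite -(field_equation k xi hu (ha j) (rf j)); congr (_ + _ * _).
by rewrite (modulated_expansion k xi hu (smooth_ac j)).
Qed.

Lemma partial_fourier_smooth eta : dist_smooth (partial_fourier u eta).
Proof.
apply: dist_smooth_of_rapid; first exact: partial_fourier_distribution.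
set xi := - eta.
have [C [m HC]] := dist_chr_growth hu.
have C0 : 0 <= C.
  have := HC 0; rewrite -(pmulr_lge0 C (exprn_gt0 m (@knormP1_gt0 R (n + 1) 0))).
  exact: le_trans (normc_ge0 _).
have G q : exists A : R, forall k,
    normc (U xi k) * (1 + knorm k) ^+ q <= A * (1 + knorm k) ^+ m.
  elim: q => [|q [A HA]].
    exists (C * (1 + `|xi%:~R|) ^+ m) => k; rewrite expr0 mulr1.
    apply: le_trans (HC _) _; rewrite -mulrA ler_wpM2l// -exprMn.
    apply: ler_expn_nneg; first by rewrite ltW// knormP1_gt0.
    by rewrite mulrC; exact: knorm_kapp_le.
  have [B B0 HB] := bootstrap m q (fun j => fc_rapid (smooth_ac j)).
  have [D D0 HD] := rhs_decay q 0 sf.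
  exists (A * (1 + B * `|xi%:~R|) + D *+ n).
  apply: HB => // j k; rewrite U_equation normc_opp.
  by have := HD j k xi; rewrite expr0 mulr1.
(* The iteration never improves the growth factor [(1 + |k|)^m] inherited from the order of [u]; [m]
   extra gains compensate it. *)
move=> p; have [A HA] := G (p + m)%N.
exists ((2 * pi)^-1 * A) => k.
have i0 : 0 <= (2 * pi : R)^-1 by rewrite invr_ge0 ltW// twopi_gt0.
rewrite partial_fourier_chr normcM normc_real ger0_norm// -mulrA ler_wpM2l//.
have k0 : 0 < (1 + knorm k : R) ^+ m by rewrite exprn_gt0// knormP1_gt0.
by rewrite -(ler_pM2r k0) -mulrA -exprD; exact: HA.
Qed.

(** Identifies [dg + i eta a_j g] with the partial Fourier coefficient of [f j] at [eta], by
    comparing coefficients in [t]. The frequencies are [- k] and [- eta] since coefficients are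
    tests against conjugate characters. *)
Let h_coefficients eta g j k : smooth_torus g -> represents g (partial_fourier u eta) ->
  fc (fun x => cpartial j g x + (0 +i* (eta%:~R * a j x)) * g x) k =
  ((2 * pi) ^- n)%:C * ((2 * pi)^-1)%:C *
    torus_cint (fun z => f j z * chr (kapp (- k) (- eta)) z).
Proof.
move=> sg rg; have cg := smooth_torus_continuous sg.
have cag : ccontinuous (fun x => ac j x * g x).
  by apply: ccontinuousM => //; exact: smooth_torus_continuous.
have -> : (fun x => cpartial j g x + (0 +i* (eta%:~R * a j x)) * g x) =
    fun x => cpartial j g x + (0 +i* eta%:~R) * (ac j x * g x).
  apply/funext => x; rewrite [in RHS]mulrA; congr (_ + _ * _).
  by apply: complexP; rewrite /= ?mul0r ?mulr0 ?subr0 ?addr0 ?add0r.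
rewrite fcD; last 2 first.
- by apply: smooth_torus_continuous; exact: smooth_torus_cpartial.
- by apply: ccontinuousM => //; exact: ccontinuous_cst.
rewrite fcZ// fc_cpartial//.
have -> : fc g k = ((2 * pi) ^- n)%:C * ((2 * pi)^-1)%:C * U (- eta) (- k).
  by rewrite (represents_fc k rg) partial_fourier_chr mulrA.
have -> : fc (fun x => ac j x * g x) k = ((2 * pi) ^- n)%:C * ((2 * pi)^-1)%:C *
    u (modulated (kapp (- k) (- eta)) (ac j)).
  rewrite /fc -[RHS]mulrA; congr (_ * _).
  have sac : smooth_torus (fun x => ac j x * chr (- k) x).
    by apply: smooth_torusM => //; exact: smooth_torus_chr.
  have -> : (fun x => ac j x * g x * chr (- k) x) = fun x => g x * (ac j x * chr (- k) x).
    by apply/funext => x; ring.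
  rewrite -(rg _ sac) partial_fourierE; congr (_ * u _).
  apply/funext => z; rewrite /modulated -mulrA; congr (_ * _).
  by rewrite !chr_kapp chr0 mul1r.
have := field_equation (- k) (- eta) hu (ha j) (rf j).
rewrite -/(U _ _) -/(ac j) ik_opp => E.
have -> : (0 +i* eta%:~R) = - (0 +i* (- eta)%:~R) :> R[i].
  by apply: complexP; rewrite /= ?oppr0// mulrNz opprK.
rewrite -[torus_cint _]opprK -E; ring.
Qed.

Let h_decay M : exists2 D : R, 0 <= D & forall eta g j x,
  smooth_torus g -> represents g (partial_fourier u eta) ->
  normc (cpartial j g x + (0 +i* (eta%:~R * a j x)) * g x) <=
    D * (1 + `|eta%:~R|) ^- M.
Proof.
(* The [n.*2] powers of [1 + |k|] supply the weight [wt], so the series of [h] gives a pointwise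
   bound while all [M] powers of [1 + |eta|] are kept. *)
have [D D0 HD] := rhs_decay n.*2 M sf.
pose c : R := (2 * pi) ^- n * (2 * pi)^-1.
have c0 : 0 <= c.
  by rewrite mulr_ge0 ?invr_ge0 ?exprn_ge0// ltW// twopi_gt0.
have T0 := @tail_ge0 R n 0.
exists (2 * (c * D) * tail n 0).
  by apply: mulr_ge0 => //; apply: mulr_ge0 => //; exact: mulr_ge0.
move=> eta g j x sg rg.
pose h y := cpartial j g y + (0 +i* (eta%:~R * a j y)) * g y.
have sh : smooth_torus h.
  apply: smooth_torusD; first exact: smooth_torus_cpartial.
  apply: smooth_torusM => //.
  have -> : (fun y => 0 +i* (eta%:~R * a j y)) = fun y => (0 +i* eta%:~R) * ac j y.
    apply/funext => y.
    by apply: complexP; rewrite /= ?mul0r ?mulr0 ?subr0 ?addr0 ?add0r.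
  by apply: smooth_torusM => //; exact: smooth_torus_cst.
rewrite -/(h x) -(fourier_inversion sh).
set e := (1 + `|eta%:~R|) ^- M.
have e0 : 0 < (1 + `|eta%:~R| : R) ^+ M by rewrite exprn_gt0// ltr_wpDr.
have -> : 2 * (c * D) * tail n 0 * e = 2 * (c * D * e) * tail n 0 by ring.
apply: normc_lsum; apply: dom_chr => k.
rewrite /h h_coefficients// -rmorphM normcM normc_real ger0_norm// -/c.
have -> : c * D * e * wt k = c * (D * (e * wt k)) by ring.
apply: ler_wpM2l => //.
have := HD j (- k) (- eta); rewrite knormN mulrNz normrN.
rewrite -(ler_pdivlMr _ _ e0) -(ler_pdivlMr _ _ (exprn_gt0 _ (knormP1_gt0 k))).
by rewrite -mulrA.
Qed.

Let U_base s :
  (forall k : nat, exists2 C : R, 0 < C & forall eta : int,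
     `|value_at (partial_fourier u eta) s| <= (C * (1 + `|eta%:~R|) ^- k)%:C) ->
  forall M, exists A : R, forall xi k, normc (U xi k) * (1 + `|xi%:~R|) ^+ M <= A.
Proof.
move=> hs M; have [C C0 HC] := hs M; have [D D0 HD] := h_decay M.
have [K K0 HK] := @torus_propagation R n.
have t0 := @twopi_gt0 R.
exists (2 * pi * (2 * (K * (C + D)) * (2 * pi) ^+ n)) => xi k.
(* [U xi k] tests against [exp (i x xi)], hence the coefficient at [- xi]; the decay bounds depend
   only on the absolute value. *)
have [g sg rg] := partial_fourier_smooth (- xi).
have e0 : 0 < (1 + `|xi%:~R| : R) ^+ M by rewrite exprn_gt0// ltr_wpDr.
set e := (1 + `|xi%:~R| : R) ^- M.
have e'0 : 0 <= e by rewrite invr_ge0 ltW.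
have gs : normc (g s) <= C * e.
  have := HC (- xi); rewrite (value_at_represents s sg rg) le_normc_lec.
  by rewrite mulrNz normrN.
have gx x : normc (g x) <= K * (C + D) * e.
  have H j y : normc (cpartial j g y + (0 +i* ((- xi)%:~R * a j y)) * g y) <= D * e.
    by have := HD (- xi) g j y sg rg; rewrite [in leRHS]mulrNz normrN.
  have := HK g (fun j y => (- xi)%:~R * a j y) (D * e) s sg (mulr_ge0 D0 e'0) H x.
  move/le_trans; apply; rewrite -mulrA ler_wpM2l ?(ltW K0)//.
  by rewrite mulrDl lerD2r.
have UE : U xi k = (2 * pi)%:C * torus_cint (fun x => g x * chr k x).
  rewrite -(rg _ (@smooth_torus_chr R n k)) partial_fourier_chr opprK.
  by rewrite mulrA -rmorphM mulfV ?gt_eqF// mul1r.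
rewrite UE normcM normc_real ger0_norm ?(ltW t0)// -[leLHS]mulrA.
rewrite ler_wpM2l ?(ltW t0)// -ler_pdivlMr//.
have -> : 2 * (K * (C + D)) * (2 * pi) ^+ n / (1 + `|xi%:~R|) ^+ M =
   2 * (K * (C + D) * e) * (2 * pi) ^+ n by rewrite -/e; ring.
apply: normc_torus_cint.
  by apply: ccontinuousM; [exact: smooth_torus_continuous|exact: chr_ccontinuous].
by move=> x; rewrite normcM normc_chr mulr1.
Qed.

(** Here [bootstrap] is used with [m = 0], since [U_base] is bounded in [k]. Quantifying [M] inside
    the induction on [q] lets each gain in [k] consume one power of [1 + |xi|]. *)
Lemma joint_decay s :
  (forall k : nat, exists2 C : R, 0 < C & forall eta : int,
     `|value_at (partial_fourier u eta) s| <= (C * (1 + `|eta%:~R|) ^- k)%:C) ->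
  forall q M, exists A : R, forall xi k,
    normc (u (chr (kapp k xi))) * (1 + knorm k) ^+ q * (1 + `|xi%:~R|) ^+ M <= A.
Proof.
move=> hs; elim=> [|q IH] M.
  by have [A HA] := U_base hs M; exists A => xi k; rewrite expr0 mulr1; exact: HA.
(* The extra power of [x = 1 + |xi|] pays for the loss, as [(1 + B |xi|) / x <= 1 + B]. *)
have [A HA] := IH M.+1.
have [B B0 HB] := bootstrap 0 q (fun j => fc_rapid (smooth_ac j)).
have [D D0 HD] := rhs_decay q M sf.
exists (A * (1 + B) + D *+ n) => xi k.
set x : R := 1 + `|xi%:~R|.
have x1 : 1 <= x by rewrite lerDl.
have xM p : 0 < x ^+ p by rewrite exprn_gt0//; lra.
have A0 : 0 <= A.
  by apply: le_trans (HA 0 0); rewrite !mulr_ge0 ?normc_ge0 ?exprn_ge0 ?addr_ge0 ?knorm_ge0.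
have H1 l : normc (U xi l) * (1 + knorm l) ^+ q <= (A / x ^+ M.+1) * (1 + knorm l) ^+ 0.
  by rewrite expr0 mulr1 ler_pdivlMr//; exact: HA.
have H2 j l : normc (ik l j * U xi l + (0 +i* xi%:~R) *
    lsum (fun p => fc (ac j) p * U xi (p + l))) * (1 + knorm l) ^+ q <= D / x ^+ M.
  by rewrite U_equation normc_opp ler_pdivlMr//; exact: HD.
have D1 : 0 <= D / x ^+ M by rewrite divr_ge0// ltW.
have := HB (U xi) xi%:~R _ _ D1 H1 H2 k; rewrite expr0 mulr1 => H.
apply: (@le_trans _ _ ((A / x ^+ M.+1 * (1 + B * `|xi%:~R|) + (D / x ^+ M) *+ n) * x ^+ M)).
  by rewrite ler_wpM2r// ltW.
rewrite mulrDl; apply: lerD; last first.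
  by rewrite -mulr_natl -[D *+ n]mulr_natl -mulrA divfK// gt_eqF.
have xn0 : x != 0 by rewrite gt_eqF//; lra.
have -> : A / x ^+ M.+1 * (1 + B * `|xi%:~R|) * x ^+ M = A * ((1 + B * `|xi%:~R|) / x).
  by rewrite exprS; field; rewrite xn0 expf_neq0.
rewrite ler_wpM2l// ler_pdivrMr; last lra.
have -> : `|xi%:~R| = x - 1 :> R by rewrite /x; ring.
have : B * 0 <= B by rewrite mulr0.
by rewrite mulrDl mul1r mulrBr; lra.
Qed.

End Solution.
End VectorFieldSystem.

Theorem theorem1p2 (R : realType) (n : nat) (a : 'I_n -> 'rV[R]_n -> R)
    (ha : forall j : 'I_n, smooth_torus_real (a j))
    (u : functional R (n + 1)) (hu : is_distribution u)
    (hX : forall j : 'I_n, dist_smooth (vector_field a j u))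
    (hs : exists s : 'rV[R]_n, forall k : nat, exists2 C : R, 0 < C &
       forall xi : int,
         `|value_at (partial_fourier u xi) s|
           <= (C * (1 + `|xi%:~R|) ^- k)%:C) :
  dist_smooth u.
Proof.
have /choice[f Hf] : forall j, exists f, smooth_torus f /\ represents f (vector_field a j u).
  by move=> j; have [f sf rf] := hX j; exists f.
have [s Hs] := hs.
have decay := joint_decay ha hu (fun j => (Hf j).1) (fun j => (Hf j).2) Hs.
apply: dist_smooth_of_rapid => // m.
(* The same exponent in both variables suffices, since [1 + |(k, xi)|] is at most
   [(1 + |k|) (1 + |xi|)]. *)
have [A HA] := decay m m; exists A => K.
have [k [xi ->]] := kapp_surj K.
apply: le_trans (HA xi k); rewrite -mulrA ler_wpM2l ?normc_ge0// -exprMn.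
apply: ler_expn_nneg; first by rewrite ltW// knormP1_gt0.
exact: knorm_kapp_le.
Qed.
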